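(* Let $s\in(0,1)$, $p\in(1,+\infty)$, $N\geqslant1$, and let $\Omega\subset\mathbb{R}^N$ be a bounded open set. Let $u\in\widetilde{W}_0^{s,p}(\Omega)$ be a second eigenfunction. Assume that there exists a function $v\in\widetilde{W}_0^{s,p}(\Omega)$ such that $v^\pm\not\equiv0$ in $\Omega$ and, for each choice of sign $\pm$ (the same sign throughout each inequality), $$\int_\Omega|v^\pm|^p\,dx\geqslant\int_\Omega|u^\pm|^p\,dx\quad\text{and}\quad\langle D[v]_p^p,v^\pm\rangle\leqslant\langle D[u]_p^p,u^\pm\rangle.$$ Then $v$ is a second eigenfunction and equalities hold in all of these inequalities.
   Context: $\|\cdot\|_p$ is the norm of $L^p(\mathbb{R}^N)$, $[u]_p=\left(\int_{\mathbb{R}^N}\int_{\mathbb{R}^N}\frac{|u(x)-u(y)|^p}{|x-y|^{N+ps}}\,dx\,dy\right)^{1/p}$, $W^{s,p}(\mathbb{R}^N)=\{u\in L^p(\mathbb{R}^N):[u]_p<+\infty\}$. $\widetilde{W}_0^{s,p}(\Omega)$ is the completion of $C_0^\infty(\Omega)$ (functions extended by zero to $\mathbb{R}^N$) with respect to the norm $\|\cdot\|_p+[\cdot]_p$. For $u,\xi\in W^{s,p}(\mathbb{R}^N)$, $$\langle D[u]_p^p,\xi\rangle=p\int_{\mathbb{R}^N}\int_{\mathbb{R}^N}\frac{|u(x)-u(y)|^{p-2}(u(x)-u(y))(\xi(x)-\xi(y))}{|x-y|^{N+ps}}\,dx\,dy.$$ $v^+=\max\{v,0\}$, $v^-=\min\{v,0\}$.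 Let $\mathcal{S}=\{u\in\widetilde{W}_0^{s,p}(\Omega):\|u\|_p=1\}$, let $S^1$ be a circle in $\mathbb{R}^2$, and let $\mathcal{G}_2$ be the family of all $\mathcal{A}\subset\mathcal{S}$ for which there is a continuous odd surjection $h:S^1\to\mathcal{A}$. The second eigenvalue of the fractional Dirichlet $p$-Laplacian in $\Omega$ is $\lambda_2=\inf_{\mathcal{A}\in\mathcal{G}_2}\sup_{u\in\mathcal{A}}[u]_p^p$. A second eigenfunction is a nonzero $u\in\widetilde{W}_0^{s,p}(\Omega)$ such that $\frac1p\langle D[u]_p^p,\xi\rangle=\lambda_2\int_\Omega|u|^{p-2}u\,\xi\,dx$ for all $\xi\in\widetilde{W}_0^{s,p}(\Omega)$. *)

(* Defs.v *)
From HB Require Import structures.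
From mathcomp Require Import all_boot all_order all_algebra.
From mathcomp Require Import all_classical all_reals all_analysis.

Set Implicit Arguments.
Unset Strict Implicit.
Unset Printing Implicit Defensive.
Import Order.TTheory GRing.Theory Num.Theory.
Import numFieldNormedType.Exports.

Local Open Scope classical_set_scope.
Local Open Scope ring_scope.

Definition measure_rV_display : measure_display.
Proof. exact: default_measure_display. Qed.

Section measurable_rV.
Context {R : realType} (n : nat).

Let coors : 'I_n -> 'rV[R]_n -> measurableTypeR R := fun i x => x ord0 i.

Let rV_set0 : g_sigma_preimage coors set0.
Proof. exact: sigma_algebra0. Qed.

Let rV_setC A : g_sigma_preimage coors A -> g_sigma_preimage coors (~` A).
Proof. exact: sigma_algebraC. Qed.

Let rV_bigcup (F : _^nat) : (forall i, g_sigma_preimage coors (F i)) ->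
  g_sigma_preimage coors (\bigcup_i (F i)).
Proof. exact: sigma_algebra_bigcup. Qed.

(* The sigma-algebra on R^n generated by the coordinates, i.e. the Borel one. *)
HB.instance Definition _ := @isMeasurable.Build measure_rV_display
  'rV[R]_n (g_sigma_preimage coors) rV_set0 rV_setC rV_bigcup.

End measurable_rV.

Section lebesgue_rV.
Context {R : realType}.

Lemma measurable_coord n (i : 'I_n) :
  measurable_fun [set: 'rV[R]_n] (fun x : 'rV[R]_n => x ord0 i).
Proof.
move=> _ Y mY; rewrite setTI; apply: sub_sigma_algebra => /=.
rewrite -bigcup_seq/=; exists i => /=; first by rewrite mem_index_enum.
by exists Y => //; rewrite setTI.
Qed.

Lemma measurable_fun_rV d (T : measurableType d) n (f : T -> 'rV[R]_n) :
  (forall i, measurable_fun [set: T] (fun x => f x ord0 i)) ->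
  measurable_fun [set: T] f.
Proof.
move=> mf _ Y; rewrite setTI => mY.
suff : preimage_set_system [set: T] f
    (g_sigma_preimage (fun (i : 'I_n) (x : 'rV[R]_n) =>
       x ord0 i : measurableTypeR R)) `<=` measurable.
  by apply; exists Y => //; rewrite setTI.
rewrite -g_sigma_preimage_comp.
apply: smallest_sub; first exact: sigma_algebra_measurable.
case: n => [|n] in f mf Y mY *; first by rewrite big_ord0.
rewrite -bigcup_mkord_ord; apply: bigcup_sub => i Ii.
by move=> A [B mB <-]; exact: mf.
Qed.

Definition rV_cons n (z : measurableTypeR R * 'rV[R]_n) : 'rV[R]_n.+1 :=
  \row_i oapp (z.2 ord0) z.1 (unlift ord0 i).

Definition rV_uncons n (x : 'rV[R]_n.+1) : measurableTypeR R * 'rV[R]_n :=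
  (x ord0 ord0, \row_i x ord0 (lift ord0 i)).

Lemma rV_consK n : cancel (@rV_cons n) (@rV_uncons n).
Proof.
move=> [a v]; rewrite /rV_cons /rV_uncons; congr pair.
  by rewrite mxE unlift_none.
by apply/rowP => i; rewrite !mxE liftK.
Qed.

Lemma measurable_rV_cons n : measurable_fun setT (@rV_cons n).
Proof.
apply: measurable_fun_rV => i.
under eq_fun do rewrite mxE.
case: unliftP => [j _|_] /=; last exact: measurable_fst.
exact: (measurableT_comp (measurable_coord j) measurable_snd).
Qed.

Lemma measurable_rV_uncons n : measurable_fun setT (@rV_uncons n).
Proof.
apply: measurable_fun_pair; first exact: measurable_coord.
apply: measurable_fun_rV => i.
under eq_fun do rewrite mxE.
exact: measurable_coord.
Qed.

Local Open Scope ereal_scope.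

Section step.
Variables (n : nat) (m : {sigma_finite_measure set 'rV[R]_n -> \bar R}).

Definition lebesgue_rV_step : set 'rV[R]_n.+1 -> \bar R :=
  fun A => (@lebesgue_measure R \x m) (@rV_cons n @^-1` A).

Let step0 : lebesgue_rV_step set0 = 0.
Proof. by rewrite /lebesgue_rV_step preimage_set0 measure0. Qed.

Let step_ge0 A : 0 <= lebesgue_rV_step A.
Proof. exact: measure_ge0. Qed.

Let step_sigma_additive : semi_sigma_additive lebesgue_rV_step.
Proof.
move=> F mF tF mUF; rewrite /lebesgue_rV_step preimage_bigcup.
apply: measure_semi_sigma_additive.
- by move=> k; rewrite -[X in measurable X]setTI; exact: measurable_rV_cons.
- apply/trivIsetP => /= i j _ _ ij; rewrite -preimage_setI.
  by move/trivIsetP : tF => /(_ _ _ _ _ ij) ->//; rewrite preimage_set0.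
- rewrite -preimage_bigcup -[X in measurable X]setTI.
  exact: measurable_rV_cons.
Qed.

HB.instance Definition _ := isMeasure.Build _ _ _ lebesgue_rV_step
  step0 step_ge0 step_sigma_additive.

Let lebesgue_rV_step_sigma_finite : sigma_finite setT lebesgue_rV_step.
Proof.
have /sigma_finiteP[F [TF ndF Foo]] := sigma_finiteT (@lebesgue_measure R).
have /sigma_finiteP[G [TG ndG Goo]] := sigma_finiteT m.
exists (fun k => @rV_uncons n @^-1` (F k `*` G k)).
  rewrite -preimage_bigcup; apply/esym/seteqP; split => // x _ /=.
  have [i _ Fi] : (\bigcup_i F i) (@rV_uncons n x).1 by rewrite -TF.
  have [j _ Gj] : (\bigcup_i G i) (@rV_uncons n x).2 by rewrite -TG.
  exists (maxn i j) => //; split.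
    by apply: (subsetPset _ _ (ndF _ _ (leq_maxl i j))).
  by apply: (subsetPset _ _ (ndG _ _ (leq_maxr i j))).
move=> k; have [mF Fk] := Foo k; have [mG Gk] := Goo k; split.
  rewrite -[X in measurable X]setTI; apply: measurable_rV_uncons => //.
  exact: measurableX.
rewrite /lebesgue_rV_step -comp_preimage.
rewrite (_ : _ \o _ = id); last by apply/funext => z; exact: rV_consK.
by rewrite preimage_id product_measure1E// lte_mul_pinfty// ge0_fin_numE.
Qed.

HB.instance Definition _ := Measure_isSigmaFinite.Build _ _ _ lebesgue_rV_step
  lebesgue_rV_step_sigma_finite.

End step.

(* Lebesgue measure on R^n: the n-fold product of lebesgue_measure. *)
Fixpoint lebesgue_rV (n : nat) : {sigma_finite_measure set 'rV[R]_n -> \bar R} :=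
  match n with
  | 0%N => \d_(0%R : 'rV[R]_0)
  | n'.+1 => lebesgue_rV_step (lebesgue_rV n')
  end.

Lemma lebesgue_rV_box n (A : 'I_n -> set (measurableTypeR R)) :
  (forall i, measurable (A i)) ->
  lebesgue_rV n [set x | forall i, A i (x ord0 i)] =
  \prod_(i < n) lebesgue_measure (A i).
Proof.
elim: n A => [|n IH] A mA /=.
  rewrite big_ord0 diracE mem_set// => -[].
  by [].
rewrite /lebesgue_rV_step /=.
have -> : @rV_cons n @^-1` [set x | forall i, A i (x ord0 i)] =
    A ord0 `*` [set x : 'rV[R]_n | forall i, A (lift ord0 i) (x ord0 i)].
  apply/seteqP; split => [[a v] /= H|[a v] /= [H0 H] i].
    split; first by have := H ord0; rewrite mxE unlift_none.
    by move=> i; have := H (lift ord0 i); rewrite mxE liftK.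
  by rewrite mxE; case: unliftP => [j|] -> //=.
have mB : measurable [set x : 'rV[R]_n | forall i, A (lift ord0 i) (x ord0 i)].
  rewrite (_ : [set _ | _] = \bigcap_(i in [set: 'I_n])
      (fun x : 'rV[R]_n => x ord0 i) @^-1` A (lift ord0 i)); last first.
    by apply/seteqP; split => [x /= H i _|x /= H i]; [exact: H|exact: (H i I)].
  apply: fin_bigcap_measurable => // i _.
  rewrite -[X in measurable X]setTI.
  exact: (measurable_coord i measurableT (mA (lift ord0 i))).
rewrite product_measure1E// big_ord_recl; congr (_ * _).
exact: (IH (fun i => A (lift ord0 i))).
Qed.

End lebesgue_rV.

Arguments lebesgue_rV R n : clear implicits.

Section fractional_sobolev.
Context {R : realType} {N : nat}.
Local Notation E := 'rV[R]_N.
Local Notation mu := (lebesgue_rV R N).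
Implicit Types (s p : R) (u v xi phi : E -> R) (Omega : set E).

(* The norm `|x| of the library on 'rV[R]_N is the max norm. *)
Definition enorm (x : E) : R := Num.sqrt (\sum_i x ord0 i ^+ 2).

Definition ppart v : E -> R := fun x => Num.max (v x) 0.

(* Nonpositive, unlike the library's f^\-. *)
Definition npart v : E -> R := fun x => Num.min (v x) 0.

Definition gagliardo s p u : \bar R :=
  ((\int[mu \x mu]_z
    (`|u z.1 - u z.2| `^ p / enorm (z.1 - z.2) `^ (N%:R + p * s))%:E)
   `^ p^-1)%E.

Definition Wsp_norm s p u : \bar R :=
  ('N[mu]_p%:E[EFin \o u] + gagliardo s p u)%E.

(* Elements of function spaces are represented by measurable functions; *)
(* below, equality and vanishing of such elements mean almost everywhere. *)
Definition Wsp s p : set (E -> R) :=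
  [set u | u \in Lfun mu p%:E /\ (gagliardo s p u < +oo)%E].

Definition partials (l : seq 'I_N) phi : E -> R :=
  foldr (fun i f => 'D_(delta_mx ord0 i) f) phi l.

Definition smooth phi : Prop := forall l : seq 'I_N,
  continuous (partials l phi) /\
  forall (i : 'I_N) (x : E), derivable (partials l phi) x (delta_mx ord0 i).

Definition Cc_infty Omega : set (E -> R) :=
  [set phi | smooth phi /\
     let supp := closure [set x | phi x != 0] in
     compact supp /\ supp `<=` Omega].

(* The completion of Cc_infty, realized as its closure in the Banach space *)
(* Wsp s p. *)
Definition W0sp s p Omega : set (E -> R) :=
  [set u | Wsp s p u /\
     forall e : R, 0 < e -> exists2 phi, Cc_infty Omega phi &
       (Wsp_norm s p (phi \- u)%R < e%:E)%E].

(* The pairing <D[u]_p^p, xi>. *)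
Definition D_gagliardo s p u xi : R :=
  p * \int[(mu \x mu)%E]_z
    (`|u z.1 - u z.2| `^ (p - 2) * (u z.1 - u z.2) * (xi z.1 - xi z.2)
     / enorm (z.1 - z.2) `^ (N%:R + p * s)).

Definition Lp_sphere s p Omega : set (E -> R) :=
  [set u | W0sp s p Omega u /\ ('N[mu]_p%:E[EFin \o u] = 1)%E].

Definition circle : set (R * R) := [set t | t.1 ^+ 2 + t.2 ^+ 2 = 1].

Definition G2 s p Omega : set (set (E -> R)) :=
  [set A | A `<=` Lp_sphere s p Omega /\
     exists h : R * R -> (E -> R),
       [/\ forall t, circle t -> A (h t),
           forall u, A u -> exists2 t, circle t & h t = u %[ae mu],
           forall t, circle t -> h (- t) = \- h t %[ae mu] &
           forall t, circle t -> forall e : R, 0 < e ->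
             \forall t' \near within circle (nbhs t),
               (Wsp_norm s p (h t' \- h t)%R < e%:E)%E]].

Definition lambda2 s p Omega : \bar R :=
  ereal_inf [set ereal_sup [set (gagliardo s p u `^ p)%E | u in A]
            | A in G2 s p Omega].

(* The equation lives in \bar R since lambda2 is an infimum of extended reals. *)
Definition second_eigenfunction s p Omega u : Prop :=
  [/\ W0sp s p Omega u,
      ~ (u = cst 0 %[ae mu]) &
      forall xi, W0sp s p Omega xi ->
        (p^-1 * D_gagliardo s p u xi)%:E =
        (lambda2 s p Omega *
         (\int[mu]_(x in Omega) (`|u x| `^ (p - 2) * u x * xi x))%R%:E)%E].

End fractional_sobolev.

(* Main.v *)
Require Import Defs.
From HB Require Import structures.
From mathcomp Require Import all_boot all_order all_algebra.
From mathcomp Require Import all_classical all_reals all_analysis.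
From mathcomp Require Import measurable_realfun ring lra.

Import Order.TTheory GRing.Theory Num.Theory.
Import numFieldNormedType.Exports.
Local Open Scope classical_set_scope.
Local Open Scope ring_scope.

Set Implicit Arguments.
Unset Strict Implicit.
Unset Printing Implicit Defensive.

(** Write [w] for a function, [lam] for the second eigenvalue, [energy w] for
the p-th power of the Gagliardo seminorm, [mass w] for the integral of
[|w|^p], and consider the plane of functions [a v^+ + b v^-].

The differences of [v^+] and of [v^-] between two points never have opposite
signs. Jensen's inequality for [|t|^p] therefore gives, after integration,

  energy (a v^+ + b v^-)
    <= |a|^p <D[v]^p, v^+> / p + |b|^p <D[v]^p, v^-> / p,

and strictly so when [a] differs from [b], since both differences are nonzero
when [v] is positive at one point and negative at the other
([energy_parts_le], [energy_parts_lt]). The equation of [u] tested with [u^+]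
and [u^-], together with the four hypotheses on [v], bounds the right-hand side
by [lam * mass (a v^+ + b v^-)].

On the other hand, normalising the circle [a^2 + b^2 = 1] of a plane spanned by
two functions of the space yields an admissible odd loop in the unit sphere, so
[energy - lam * mass] cannot be negative all along such a circle
([loop_not_below]). As it is negative off the diagonal [a = b], it has to vanish
on the diagonal, that is at [v], and all the inequalities used are equalities
([comparison_equalities]).

If [v] violated the eigenvalue equation for a test function [xi], then
[energy - lam * mass] would have a negative slope at [v] in the direction [xi]
(up to the sign of [xi]). For small [e > 0] the plane spanned by [v^+ + e xi]
and [v^- + e xi] moves the point [a v^+ + b v^-] by [e (a + b) xi]: near the
diagonal this strictly decreases [energy - lam * mass] from a nonpositive
value, elsewhere negativity persists by continuity, and compactness of the
circle makes one [e] work everywhere ([deform_below]). This contradicts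
[loop_not_below] for the new plane.

Two facts on the function space are needed along the way. Its elements vanish
almost everywhere outside [Omega] ([W0sp_out]), so that integrals over [Omega]
are integrals over the whole space; and it is stable under [v^+] and [v^-]
([W0sp_ppart]): test functions converging fast to [v] are composed with smooth
1-Lipschitz approximations of the positive part, and dominated convergence
applies, both to the functions and to their difference quotients.

The seminorm is treated as an L^p norm over pairs of points throughout, namely
that of [gdiff w z = (w z.1 - w z.2) * kernel z], which is linear in [w]. *)

(** * Pointwise inequalities for powers *)

Section real_inequalities.
Context {R : realType}.
Implicit Types (p x y a b c s t : R).

(** For [x > 0] let [t = ln x]; dividing by [x] turns the claim into
[p < exp ((p - 1) t) + (p - 1) exp (- t)], the sum of two strict instances of
[1 + t < exp t]. *)
Lemma powR_bernoulli_lt p x : 1 < p -> 0 <= x -> x != 1 ->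
  p * x < x `^ p + (p - 1).
Proof.
move=> p1; rewrite le_eqVlt => /predU1P[<- _|x0 x1].
  by rewrite mulr0 powR0 ?add0r ?subr_gt0// gt_eqF// (lt_trans ltr01).
have t0 : ln x != 0 by rewrite ln_eq0.
have pt0 : (p - 1) * ln x != 0 by rewrite mulf_neq0// subr_eq0 gt_eqF.
have h1 := expR_gt1Dx pt0.
have h2 : 1 - ln x < expR (- ln x) by apply: expR_gt1Dx; rewrite oppr_eq0.
have xE : x * expR (- ln x) = 1 by rewrite expRN lnK// divff// gt_eqF.
have -> : x `^ p = x * expR ((p - 1) * ln x).
  rewrite -mulr_powRB1 ?(ltW x0) ?(lt_trans ltr01)//.
  by rewrite /powR (gt_eqF x0).
have h3 : p < expR ((p - 1) * ln x) + (p - 1) * expR (- ln x).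
  have : (p - 1) * (1 - ln x) < (p - 1) * expR (- ln x).
    by rewrite ltr_pM2l// subr_gt0.
  by lra.
have -> : x * expR ((p - 1) * ln x) + (p - 1) =
    (expR ((p - 1) * ln x) + (p - 1) * expR (- ln x)) * x.
  rewrite [RHS]mulrDl -[(_ * _) * x]mulrA [expR (- _) * _]mulrC xE.
  by rewrite mulr1 (mulrC x).
by rewrite ltr_pM2r.
Qed.

(** The derivative of [|x|^p / p]; the value at 0 is 0 because of the factor [x],
also when [p < 2]. *)
Definition phi p x := `|x| `^ (p - 2) * x.

Lemma phi0 p : phi p 0 = 0.
Proof. by rewrite /phi mulr0. Qed.

Lemma phi_mul p x : 0 < p -> phi p x * x = `|x| `^ p.
Proof.
move=> p0; rewrite /phi; have [->|x0] := eqVneq x 0.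
  by rewrite !mulr0 normr0 powR0// gt_eqF.
rewrite -mulrA -expr2 -real_normK ?num_real// -powR_mulrn//.
by rewrite -powRD ?subrK// normr_eq0 x0 implybT.
Qed.

Lemma phiM p a x : phi p (a * x) = phi p a * phi p x.
Proof. by rewrite /phi normrM powRM// mulrACA. Qed.

Lemma norm_phi p x : 1 < p -> `|phi p x| = `|x| `^ (p - 1).
Proof.
move=> p1; rewrite /phi; have [->|x0] := eqVneq x 0.
  by rewrite mulr0 normr0 powR0// subr_eq0 gt_eqF.
rewrite normrM ger0_norm ?powR_ge0//.
have -> : p - 2 = (p - 1) - 1 by lra.
by rewrite mulrC mulr_powRB1// subr_gt0.
Qed.

(** Gives integrable bounds for the pairings with [phi] without Hoelder's
inequality: a common L^p bound [s] of both arguments suffices. *)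
Lemma norm_phi_mul_le p x y s : 1 < p -> `|x| <= s -> `|y| <= s ->
  `|phi p x * y| <= s `^ p.
Proof.
move=> p1 xs ys; have s0 : 0 <= s by rewrite (le_trans _ xs).
rewrite normrM norm_phi// -(mulr_powRB1 s0 (lt_trans ltr01 p1)) mulrC.
by apply: ler_pM => //; apply: ge0_ler_powR; rewrite ?nnegrE// subr_ge0 ltW.
Qed.

(** The graph of [|y|^p] lies above its tangent at [x], in the form of Young's
inequality. By homogeneity this is Bernoulli's inequality for [y / x]. *)
Lemma phi_tangent_lt p x y : 1 < p -> x != y ->
  p * (phi p x * y) < `|y| `^ p + (p - 1) * `|x| `^ p.
Proof.
move=> p1 xy; have p0 : 0 < p := lt_trans ltr01 p1.
have [x0|x0] := eqVneq x 0.
  rewrite x0 phi0 mul0r mulr0 normr0 powR0 ?gt_eqF// mulr0 addr0.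
  by rewrite powR_gt0// normr_gt0 eq_sym -x0.
pose s := y / x; have yE : y = s * x by rewrite /s divfK.
rewrite {}yE in xy *; move: s xy => s xy.
rewrite (mulrCA _ s) (mulrCA p) phi_mul// normrM powRM// mulrA -mulrDl.
rewrite ltr_pM2r ?powR_gt0 ?normr_gt0//.
have [s0|s0] := leP 0 s.
  rewrite mulrC ger0_norm// powR_bernoulli_lt//.
  by apply: contra_neq xy => ->; rewrite mul1r.
have : 0 <= `|s| `^ p by exact: powR_ge0.
by nra.
Qed.

Lemma phi_tangent p x y : 1 < p ->
  p * (phi p x * y) <= `|y| `^ p + (p - 1) * `|x| `^ p.
Proof.
move=> p1; have [<-|xy] := eqVneq x y; last exact/ltW/phi_tangent_lt.
by rewrite phi_mul ?(lt_trans ltr01)//; lra.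
Qed.

Let jensen_segment p a b t : 1 < p -> 0 <= t <= 1 ->
  (`|a * t + b * (1 - t)| `^ p <= `|a| `^ p * t + `|b| `^ p * (1 - t)) /\
  (0 < t < 1 -> a != b ->
   `|a * t + b * (1 - t)| `^ p < `|a| `^ p * t + `|b| `^ p * (1 - t)).
Proof.
move=> p1 /andP[t0 t1]; set m := a * t + _.
have p0 : 0 < p := lt_trans ltr01 p1.
have mm : p * (phi p m * m) = p * `|m| `^ p by rewrite phi_mul.
have mE : p * (phi p m * m) =
    t * (p * (phi p m * a)) + (1 - t) * (p * (phi p m * b)).
  by rewrite {2}/m; ring.
split.
  have ha := phi_tangent m a p1; have hb := phi_tangent m b p1.
  have := ler_wpM2l t0 ha.
  have : 0 <= 1 - t by lra.
  move=> /ler_wpM2l/(_ _ _ hb).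
  by lra.
move=> /andP[t0' t1'] ab.
have ma : m != a.
  rewrite -subr_eq0 (_ : m - a = (1 - t) * (b - a)); last by rewrite /m; ring.
  by rewrite mulf_neq0 ?subr_eq0 1?eq_sym// lt_eqF.
have mb : m != b.
  rewrite -subr_eq0 (_ : m - b = t * (a - b)); last by rewrite /m; ring.
  by rewrite mulf_neq0 ?subr_eq0// gt_eqF.
have ha := phi_tangent_lt p1 ma; have hb := phi_tangent_lt p1 mb.
have : t * (p * (phi p m * a)) < t * (`|a| `^ p + (p - 1) * `|m| `^ p).
  by rewrite ltr_pM2l.
have : (1 - t) * (p * (phi p m * b)) <
       (1 - t) * (`|b| `^ p + (p - 1) * `|m| `^ p).
  by rewrite ltr_pM2l// subr_gt0.
by lra.
Qed.

Let jensen_scaled p (al be a b c t : R) : 1 < p -> a = t * c ->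
    b = (1 - t) * c ->
  (`|al * a + be * b| `^ p = `|al * t + be * (1 - t)| `^ p * `|c| `^ p) /\
  (`|al| `^ p * (phi p c * a) + `|be| `^ p * (phi p c * b) =
   (`|al| `^ p * t + `|be| `^ p * (1 - t)) * `|c| `^ p).
Proof.
move=> p1 -> ->; have p0 : 0 < p := lt_trans ltr01 p1.
rewrite -powRM// -normrM -(phi_mul c p0); split; last by ring.
by congr (`|_| `^ _); ring.
Qed.

Let same_sign_segment a b : 0 <= a * b -> a + b != 0 ->
  exists t, [/\ 0 <= t <= 1, a = t * (a + b), b = (1 - t) * (a + b) &
    0 < a * b -> 0 < t < 1].
Proof.
move=> ab c0; pose c := a + b; pose t := a / c.
have aE : a = t * c by rewrite /t divfK.
have bE : b = (1 - t) * c by rewrite mulrBl mul1r -aE /c; lra.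
have c2 : 0 < c ^+ 2 by rewrite exprn_even_gt0.
have abE : a * b = (t * (1 - t)) * c ^+ 2 by rewrite {1}aE bE; ring.
exists t; split => //.
- have : 0 <= t * (1 - t) by move: ab; rewrite abE pmulr_lge0.
  by move=> h; have := sqr_ge0 t; nra.
- rewrite abE pmulr_lgt0// => h; have := sqr_ge0 t; nra.
Qed.

(** For [a + b <> 0] the weights [a / (a + b)] and [b / (a + b)] lie in [[0, 1]],
and the claim is the convexity of [|.|^p] at [al] and [be], multiplied by
[|a + b|^p]. *)
Lemma powR_jensen p (al be a b : R) : 1 < p -> 0 <= a * b ->
  `|al * a + be * b| `^ p <=
  `|al| `^ p * (phi p (a + b) * a) + `|be| `^ p * (phi p (a + b) * b).
Proof.
move=> p1 ab; have p0 : 0 < p := lt_trans ltr01 p1.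
have [c0|c0] := eqVneq (a + b) 0.
  have bE : b = - a by lra.
  have a0 : a = 0.
    by apply/eqP; rewrite -sqrf_eq0 eq_le sqr_ge0 andbT; move: ab; rewrite bE; lra.
  by rewrite bE a0 oppr0 !mulr0 addr0 normr0 powR0 ?gt_eqF// addr0.
have [t [t01 aE bE _]] := same_sign_segment ab c0.
have [-> ->] := jensen_scaled al be p1 aE bE.
by rewrite ler_wpM2r ?powR_ge0//; have [] := jensen_segment al be p1 t01.
Qed.

Lemma powR_jensen_lt p (al be a b : R) : 1 < p -> 0 < a * b -> al != be ->
  `|al * a + be * b| `^ p <
  `|al| `^ p * (phi p (a + b) * a) + `|be| `^ p * (phi p (a + b) * b).
Proof.
move=> p1 ab albe; have p0 : 0 < p := lt_trans ltr01 p1.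
have c0 : a + b != 0.
  apply: contraTneq ab => /eqP; rewrite addr_eq0 => /eqP ->.
  by rewrite mulNr -leNgt oppr_le0 -expr2 sqr_ge0.
have [t [t01 aE bE /(_ ab) t01']] := same_sign_segment (ltW ab) c0.
have [-> ->] := jensen_scaled al be p1 aE bE.
rewrite ltr_pM2r ?powR_gt0 ?normr_gt0//.
by have [_ ->] := jensen_segment al be p1 t01.
Qed.

End real_inequalities.

Section cont_phi.
Context {R : realType}.
Implicit Types (p r x : R).

Let powR_norm_continuous_neq0 r x : x != 0 ->
  {for x, continuous (fun y : R => `|y| `^ r)}.
Proof.
move=> x0; have h1 : {for x, continuous (fun y : R => `|y|)}.
  exact: norm_continuous.
have h2 : {for `|x|, continuous (fun y : R => y `^ r)}.
  apply/differentiable_continuous/derivable1_diffP/derivable_powR.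
  by rewrite in_itv/= andbT normr_gt0.
exact: (@continuous_comp _ _ _ (fun y : R => `|y|) (fun y => y `^ r) x h1 h2).
Qed.

(** Away from 0 the power is differentiable; at 0 the bound [|y| < e^(1/r)] gives
the modulus of continuity. *)
Lemma powR_norm_continuous r : 0 < r -> continuous (fun y : R => `|y| `^ r).
Proof.
move=> r0 x; have [->|x0] := eqVneq x 0; last exact: powR_norm_continuous_neq0.
apply/cvgrPdist_lt => e e0; rewrite normr0 powR0 ?gt_eqF//.
near=> y; rewrite sub0r normrN ger0_norm ?powR_ge0//.
have -> : e = (e `^ r^-1) `^ r by rewrite -powRrM mulVf ?gt_eqF// powRr1// ltW.
apply: gt0_ltr_powR; rewrite ?nnegrE ?powR_ge0//.
near: y.
have: 0 < e `^ r^-1 by exact: powR_gt0.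
move=> d0; apply/nbhs_ballP; exists (e `^ r^-1) => //= y /=.
rewrite /ball_ sub0r normrN; exact.
Unshelve. all: by end_near. Qed.

Lemma phi_continuous p : 1 < p -> continuous (phi p).
Proof.
move=> p1 x; have [->|x0] := eqVneq x 0; last first.
  by apply: cvgM; [exact: powR_norm_continuous_neq0|exact: cvg_id].
have := @powR_norm_continuous (p - 1); rewrite subr_gt0 => /(_ p1 0).
rewrite /continuous_at normr0 powR0 ?subr_eq0 ?gt_eqF// phi0.
move=> h; apply/norm_cvg0P.
by apply: cvg_trans h; apply: near_eq_cvg; near=> y; rewrite /= norm_phi.
Unshelve. all: by end_near. Qed.

Lemma measurable_powR_norm d (T : measurableType d) (f : T -> R) r :
  measurable_fun setT f -> measurable_fun setT (fun z => `|f z| `^ r).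
Proof.
move=> mf; apply: (measurableT_comp (measurable_powR _)).
exact: measurableT_comp.
Qed.

Lemma measurable_phi d (T : measurableType d) (f : T -> R) p :
  measurable_fun setT f -> measurable_fun setT (fun z => phi p (f z)).
Proof. by move=> mf; apply: measurable_funM => //; exact: measurable_powR_norm. Qed.

End cont_phi.

Section positive_negative_parts.
Context {R : realType}.
Implicit Types (x y : R).

Lemma max_min0 x : Num.max x 0 + Num.min x 0 = x.
Proof. by case: (lerP x 0) => _; rewrite ?add0r ?addr0. Qed.

Lemma phi_max0 p x : 0 < p -> phi p x * Num.max x 0 = `|Num.max x 0| `^ p.
Proof.
move=> p0; case: (lerP x 0) => _; last exact: phi_mul.
by rewrite mulr0 normr0 powR0// gt_eqF.
Qed.

Lemma phi_min0 p x : 0 < p -> phi p x * Num.min x 0 = `|Num.min x 0| `^ p.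
Proof.
move=> p0; case: (lerP x 0) => _; first exact: phi_mul.
by rewrite mulr0 normr0 powR0// gt_eqF.
Qed.

(** Both parts are nondecreasing functions of the value, so their increments
have the same sign. *)
Lemma diff_parts_ge0 x y :
  0 <= (Num.max x 0 - Num.max y 0) * (Num.min x 0 - Num.min y 0).
Proof.
by case: (lerP x 0) => x0; case: (lerP y 0) => y0;
  rewrite ?subrr ?mul0r ?mulr0 ?subr0 ?sub0r//; nra.
Qed.

Lemma powR_parts p (a b x : R) : 0 < p ->
  `|a * Num.max x 0 + b * Num.min x 0| `^ p =
  `|a| `^ p * `|Num.max x 0| `^ p + `|b| `^ p * `|Num.min x 0| `^ p.
Proof.
move=> p0; have pn0 : p != 0 by rewrite gt_eqF.
by case: (lerP x 0) => _;
  rewrite !mulr0 normr0 powR0// mulr0 ?add0r ?addr0 normrM powRM.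
Qed.

End positive_negative_parts.

Lemma weighted_sum_le {R : realType} (lam A B x y m n : R) : 0 <= A -> 0 <= B ->
  x <= lam * m -> y <= lam * n -> A * x + B * y <= lam * (A * m + B * n).
Proof.
move=> A0 B0 xm yn; rewrite mulrDr !(mulrCA lam).
by apply: lerD; exact: ler_wpM2l.
Qed.

Lemma squeeze_pair {R : realType} (x y a b A B : R) : x <= a -> y <= b -> a <= A ->
  b <= B -> A + B <= x + y -> [/\ x = a, y = b, A = a & B = b].
Proof. by move=> *; split; lra. Qed.

Lemma cvgn_lt0 {R : realType} (u : nat -> R) (l : R) : u @ \oo --> l -> l < 0 ->
  \forall n \near \oo, u n < 0.
Proof. by move=> ul l0; exact: (cvgr_lt l ul). Qed.

Lemma cvg_continuous_at {R : realType} (f : R -> R) (u : nat -> R) (l : R) :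
  {for l, continuous f} -> u @ \oo --> l -> (fun n => f (u n)) @ \oo --> f l.
Proof. by move=> cf ul; apply: continuous_cvg. Qed.

Lemma cvg_continuous {R : realType} (f : R -> R) (u : nat -> R) (l : R) :
  continuous f -> u @ \oo --> l -> (fun n => f (u n)) @ \oo --> f l.
Proof. by move=> cf; apply: cvg_continuous_at; exact: cf. Qed.

(** * Integration and L^p functions over a general measure space *)

Lemma ae_product d1 d2 (T1 : measurableType d1) (T2 : measurableType d2)
    {R : realType} (m1 : {sigma_finite_measure set T1 -> \bar R})
    (m2 : {sigma_finite_measure set T2 -> \bar R}) (P : set T1) (Q : set T2) :
  {ae m1, forall x, P x} -> {ae m2, forall x, Q x} ->
  {ae (m1 \x m2)%E, forall z, P z.1 /\ Q z.2}.
Proof.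
move=> [A [mA A0 PA]] [B [mB B0 QB]].
exists ((A `*` setT) `|` (setT `*` B)); split.
- by apply: measurableU; exact: measurableX.
- rewrite null_set_setU//; try exact: measurableX.
    transitivity (m1 A * m2 setT)%E; first exact: product_measure1E.
    by rewrite A0 mul0e.
  transitivity (m1 setT * m2 B)%E; first exact: product_measure1E.
  by rewrite B0 mule0.
- move=> z /not_andP[Pz|Qz]; [left; split => //; exact: PA|right; split => //; exact: QB].
Qed.

Section integral_lincomb.
Context d (T : measurableType d) {R : realType}.
Variables (m : {measure set T -> \bar R}) (a b : R) (F G : T -> R).
Hypotheses (iF : m.-integrable setT (EFin \o F)) (iG : m.-integrable setT (EFin \o G)).

Let integrable_scale c (H : T -> R) : m.-integrable setT (EFin \o H) ->
  m.-integrable setT (EFin \o (fun x => c * H x)).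
Proof.
move=> /(integrableZl measurableT c).
by apply: eq_integrable => // x _ /=; rewrite EFinM.
Qed.

Lemma integrable_lincomb : m.-integrable setT (EFin \o (fun x => a * F x + b * G x)).
Proof.
have := integrableD measurableT (integrable_scale a iF) (integrable_scale b iG).
by apply: eq_integrable => // x _ /=; rewrite EFinD.
Qed.

Lemma Rintegral_lincomb : \int[m]_x (a * F x + b * G x) =
  a * \int[m]_x F x + b * \int[m]_x G x.
Proof.
rewrite (RintegralD measurableT (integrable_scale a iF) (integrable_scale b iG)).
by rewrite (RintegralZl _ measurableT iF) (RintegralZl _ measurableT iG).
Qed.

End integral_lincomb.

Section integral_complements.
Context d (T : measurableType d) {R : realType}.
Variable m : {measure set T -> \bar R}.

(** Equality of the integrals would make [G - F >= 0] vanish almost everywhere,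
in particular on almost all of [S]. *)
Lemma Rintegral_lt (F G : T -> R) (S : set T) : measurable S -> (0 < m S)%E ->
  m.-integrable setT (EFin \o F) -> m.-integrable setT (EFin \o G) ->
  (forall x, F x <= G x) -> (forall x, S x -> F x < G x) ->
  \int[m]_x F x < \int[m]_x G x.
Proof.
move=> mS S0 iF iG FG FGS.
rewrite lt_neqAle le_Rintegral// andbT; apply/negP => /eqP FGE.
have iGF := integrableB measurableT iG iF.
have mGF : measurable_fun setT (fun x => (G x - F x)%:E) by case/integrableP : iGF.
have I0 : (\int[m]_x `|(G x - F x)%:E| = 0)%E.
  transitivity (\int[m]_x (G x - F x)%:E)%E.
    by apply: eq_integral => x _; rewrite gee0_abs// lee_fin subr_ge0.
  rewrite -[LHS]fineK; last exact: integrable_fin_num iGF.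
  congr EFin; rewrite -[LHS]/(\int[m]_x (G x - F x)) RintegralB//.
  by rewrite FGE subrr.
have /(ae_eq_integral_abs m measurableT mGF) [A [mA A0 hA]] := I0.
have : (m S <= m A)%E.
  apply: le_measure; rewrite ?inE// => x Sx; apply: hA => /= /(_ I) [] /eqP.
  by rewrite subr_eq0 => /eqP e; have := FGS _ Sx; rewrite e ltxx.
by rewrite A0 leNgt S0.
Qed.

Lemma Rintegral_support (D : set T) (F : T -> R) : measurable D ->
  measurable_fun setT F -> {ae m, forall x, ~ D x -> F x = 0} ->
  \int[m]_(x in D) F x = \int[m]_x F x.
Proof.
move=> mD mF F0; rewrite /Rintegral; congr fine; rewrite integral_mkcond.
apply: ae_eq_integral => //.
- apply/(measurable_restrictT _ mD); apply: measurable_funTS.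
  exact/measurable_EFinP.
- exact/measurable_EFinP.
apply: filterS F0 => x F0 _; rewrite /patch; case: ifPn => //.
by rewrite notin_setE => /F0 ->.
Qed.

End integral_complements.

Section Lp_space.
Context d (T : measurableType d) {R : realType}.
Variables (m : {measure set T -> \bar R}) (p : R).
Hypothesis p1 : 1 < p.
Implicit Types f g A B C : T -> R.
Local Notation L := (Lfun m p%:E).

Let p0 : 0 < p. Proof. exact: lt_trans ltr01 p1. Qed.
Let pn0 : p != 0. Proof. by rewrite gt_eqF. Qed.
Let p1E : (1 <= p%:E)%E. Proof. by rewrite lee_fin ltW. Qed.

Lemma in_LfunP f : f \in L <->
  measurable_fun setT f /\ m.-integrable setT (fun x => (`|f x| `^ p)%:E).
Proof.
split=> [fL|[mf /integrableP[_ fi]]].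
  split; last exact: Lfun_integrable (ltW p1) fL.
  by have /andP[/[!inE]] := fL.
rewrite inE; apply/andP; rewrite !inE; split => //=.
rewrite /finite_norm unlock; apply: poweR_lty.
by under eq_integral do rewrite -[(_ `^ _)%E]gee0_abs ?poweR_ge0//.
Qed.

Lemma Lfun_measurable f : f \in L -> measurable_fun setT f.
Proof. by case/in_LfunP. Qed.

Lemma Lfun_lincomb a b f g : f \in L -> g \in L ->
  (fun x => a * f x + b * g x) \in L.
Proof.
move=> fL gL; have cl := (Lfun_submod_closed m p1E).
have bgL : b *: g + 0 \in L by apply: cl.2 => //; exact: cl.1.
rewrite (_ : (fun _ => _) = a *: f + (b *: g + 0)); first exact: cl.2.
by apply/funext => x /=; rewrite addr0.
Qed.

Lemma Lfun_le f g : measurable_fun setT f -> g \in L ->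
  (forall x, `|f x| <= `|g x|) -> f \in L.
Proof.
move=> mf /in_LfunP[mg ig] fg; apply/in_LfunP; split => //.
apply: le_integrable ig => //.
  by apply/measurable_EFinP; exact: measurable_powR_norm.
move=> x _; rewrite lee_fin !(ger0_norm (powR_ge0 _ _)).
by apply: ge0_ler_powR; rewrite ?nnegrE// ltW.
Qed.

Lemma Lfun_norm f : f \in L -> (fun x => `|f x|) \in L.
Proof.
move=> fL; apply: (Lfun_le _ fL) => [|x]; last by rewrite normr_id.
by apply: measurableT_comp => //; exact: Lfun_measurable.
Qed.

Lemma integrable_Lfun_powR f : f \in L ->
  m.-integrable setT (EFin \o (fun x => `|f x| `^ p)).
Proof. by case/in_LfunP. Qed.

Lemma le_integrable_R f g : measurable_fun setT f ->
  m.-integrable setT (EFin \o g) -> (forall x, `|f x| <= g x) ->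
  m.-integrable setT (EFin \o f).
Proof.
move=> mf ig fg; apply: le_integrable ig => //; first exact/measurable_EFinP.
by move=> x _ /=; rewrite lee_fin (le_trans (fg x))// ler_norm.
Qed.

Lemma integrable_phi f g : f \in L -> g \in L ->
  m.-integrable setT (EFin \o (fun x => phi p (f x) * g x)).
Proof.
move=> fL gL; have sL := Lfun_lincomb 1 1 (Lfun_norm fL) (Lfun_norm gL).
apply: le_integrable_R (integrable_Lfun_powR sL) _.
  apply: measurable_funM; last exact: Lfun_measurable.
  by apply: measurable_phi; exact: Lfun_measurable.
move=> x; rewrite !mul1r; apply: norm_phi_mul_le => //.
  by rewrite (@ger0_norm _ (_ + _)) ?addr_ge0// lerDl.
by rewrite (@ger0_norm _ (_ + _)) ?addr_ge0// lerDr.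
Qed.

Lemma Lnorm_pow f : f \in L ->
  'N[m]_p%:E[EFin \o f]%E = ((\int[m]_x (`|f x| `^ p)) `^ p^-1)%:E.
Proof.
move=> fL; rewrite unlock -poweR_EFin; congr (_ `^ _)%E.
rewrite fineK//; exact: integrable_fin_num (integrable_Lfun_powR fL).
Qed.

Lemma Lnorm_lt f e : 0 < e -> ('N[m]_p%:E[EFin \o f] < e%:E)%E =
  (\int[m]_x (`|f x| `^ p)%:E < (e `^ p)%:E)%E.
Proof.
move=> e0; rewrite unlock.
set I := (\int[m]_x _)%E.
have I0 : (0 <= I)%E by apply: integral_ge0 => x _; rewrite lee_fin powR_ge0.
case: I I0 => [r r0| _|//].
  rewrite poweR_EFin !lte_fin.
  apply/idP/idP => h.
    have -> : r = (r `^ p^-1) `^ p by rewrite -powRrM mulVf// powRr1.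
    by apply: gt0_ltr_powR; rewrite ?nnegrE ?powR_ge0// ltW.
  have -> : e = (e `^ p) `^ p^-1 by rewrite -powRrM mulfV// powRr1// ltW.
  by apply: gt0_ltr_powR; rewrite ?invr_gt0 ?nnegrE ?powR_ge0.
by rewrite /= invr_eq0 (negbTE pn0) !ltNge !leey.
Qed.

Lemma Rintegral_cvg (f_ : nat -> T -> R) f g :
  (forall n, measurable_fun setT (f_ n)) -> measurable_fun setT f ->
  (forall x, f_ ^~ x @ \oo --> f x) ->
  m.-integrable setT (EFin \o g) -> (forall n x, `|f_ n x| <= g x) ->
  (fun n => \int[m]_x f_ n x) @ \oo --> \int[m]_x f x.
Proof.
move=> mf_ mf cf ig fg.
have [] := @dominated_convergence _ _ _ m setT measurableT
  (fun n => EFin \o f_ n) (EFin \o f) (EFin \o g).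
- by move=> n; exact/measurable_EFinP.
- exact/measurable_EFinP.
- by apply: aeW => x _; apply: cvg_EFin => //; [exact: nearW|exact: cf].
- exact: ig.
- by apply: aeW => x n _; rewrite lee_fin.
move=> fi _ h; apply: fine_cvg; rewrite fineK//.
exact: integrable_fin_num fi.
Qed.

(** Continuity of the integrals of [|w|^p] and of [phi w * C] along finite
combinations [w = a A + b B + c C]: bounded coefficients give the L^p bound
[M (|A| + |B| + |C|)] that dominates all of them. *)
Section sequences.
Variables (A B C : T -> R) (a_ b_ c_ : nat -> R) (a b c : R).
Hypotheses (AL : A \in L) (BL : B \in L) (CL : C \in L).
Hypotheses (ca : a_ @ \oo --> a) (cb : b_ @ \oo --> b) (cc : c_ @ \oo --> c).

Let X_ n x := a_ n * A x + b_ n * B x + c_ n * C x.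
Let X x := a * A x + b * B x + c * C x.

Let bound (u : nat -> R) (l : R) : u @ \oo --> l ->
  exists2 M, 0 <= M & forall n, `|u n| <= M.
Proof.
move=> ul; have /cvg_seq_bounded[M [_ hM]] : cvgn u by apply/cvg_ex; exists l.
exists (`|M| + 1); first by rewrite addr_ge0.
by move=> n; apply: hM => //; rewrite (le_lt_trans (ler_norm _))// ltrDl.
Qed.

Let dominate : exists G, [/\ G \in L, forall x, 0 <= G x,
  forall n x, `|X_ n x| <= G x & forall x, `|C x| <= G x].
Proof.
have [Ma a0 ha] := bound ca; have [Mb b0 hb] := bound cb.
have [Mc c0 hc] := bound cc.
exists (fun x => 1 * (Ma * `|A x| + Mb * `|B x|) + (Mc + 1) * `|C x|); split.
- by apply: Lfun_lincomb; [apply: Lfun_lincomb|]; exact: Lfun_norm.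
- by move=> x; rewrite mul1r !addr_ge0// mulr_ge0// addr_ge0.
- move=> n x; rewrite mul1r mulrDl addrA -[leLHS]addr0 lerD// ?mul1r//.
  rewrite /X_ (le_trans (ler_normD _ _))// lerD// ?normrM ?ler_wpM2r//.
  by rewrite (le_trans (ler_normD _ _))// lerD// normrM ler_wpM2r.
- move=> x; rewrite mul1r mulrDl mul1r addrA lerDr.
  by rewrite !addr_ge0// mulr_ge0.
Qed.

Let cvgX x : X_ ^~ x @ \oo --> X x.
Proof. by apply: cvgD; [apply: cvgD|]; apply: cvgMl. Qed.

Let mX n : measurable_fun setT (X_ n).
Proof.
apply: measurable_funD; first apply: measurable_funD;
by apply: measurable_funM => //; exact: Lfun_measurable.
Qed.

Let mX' : measurable_fun setT X.
Proof.
apply: measurable_funD; first apply: measurable_funD;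
by apply: measurable_funM => //; exact: Lfun_measurable.
Qed.

Lemma cvg_int_powR : (fun n => \int[m]_x (`|X_ n x| `^ p)) @ \oo -->
  \int[m]_x (`|X x| `^ p).
Proof.
have [G [GL G0 XG CG]] := dominate.
apply: Rintegral_cvg (integrable_Lfun_powR GL) _.
- by move=> n; exact: measurable_powR_norm.
- exact: measurable_powR_norm.
- move=> x; exact: (cvg_continuous (powR_norm_continuous p0) (@cvgX x)).
- move=> n x; rewrite ger0_norm ?powR_ge0//.
  rewrite ge0_ler_powR ?nnegrE//; first exact: ltW.
  by rewrite (le_trans (XG n x))// ler_norm.
Qed.

Lemma cvg_int_phi : (fun n => \int[m]_x (phi p (X_ n x) * C x)) @ \oo -->
  \int[m]_x (phi p (X x) * C x).
Proof.
have [G [GL G0 XG CG]] := dominate.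
have mC : measurable_fun setT C by exact: Lfun_measurable.
apply: Rintegral_cvg (integrable_Lfun_powR GL) _.
- by move=> n; apply: measurable_funM => //; exact: measurable_phi.
- by apply: measurable_funM => //; exact: measurable_phi.
- move=> x; apply: cvgM; last exact: cvg_cst.
  exact: (cvg_continuous (phi_continuous p1) (@cvgX x)).
- move=> n x; apply: norm_phi_mul_le => //; rewrite (le_trans _ (ler_norm _))//.
Qed.

End sequences.

End Lp_space.

Lemma Lnorm_lt_root d (T : measurableType d) {R : realType}
    (m : {measure set T -> \bar R}) (p : R) (f : T -> R) (e : R) : 1 < p -> 0 < e ->
  ('N[m]_p%:E[EFin \o f] < (e `^ p^-1)%:E)%E ->
  (\int[m]_x (`|f x| `^ p)%:E <= e%:E)%E.
Proof.
move=> p1 e0; have p0 : 0 < p := lt_trans ltr01 p1.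
rewrite (Lnorm_lt m p1 f (powR_gt0 _ e0)) -powRrM mulVf ?gt_eqF//.
by rewrite powRr1 ?(ltW e0)// => /ltW.
Qed.

Section Lnorm_lincomb.
Context d (T : measurableType d) {R : realType}.
Variables (m : {measure set T -> \bar R}) (p : R).
Hypothesis p1 : 1 < p.
Local Notation L := (Lfun m p%:E).
Local Notation nm f := ((\int[m]_x (`|f x| `^ p)) `^ p^-1).

Lemma Lp_norm_scale a (f : T -> R) : f \in L -> nm (fun x => a * f x) = `|a| * nm f.
Proof.
move=> fL; have p0 : 0 < p by exact: lt_trans ltr01 p1.
under eq_Rintegral do rewrite normrM powRM//.
rewrite RintegralZl//; last exact: integrable_Lfun_powR.
rewrite powRM ?powR_ge0//; last by apply: Rintegral_ge0 => x _; exact: powR_ge0.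
by rewrite -powRrM mulfV ?gt_eqF// powRr1.
Qed.

Lemma Lp_norm_lincomb a b (f g : T -> R) : f \in L -> g \in L ->
  nm (fun x => a * f x + b * g x) <= `|a| * nm f + `|b| * nm g.
Proof.
move=> fL gL.
have aL : (fun x => a * f x) \in L.
  rewrite (_ : (fun x => a * f x) = fun x => a * f x + 0 * f x).
    exact: Lfun_lincomb.
  by apply/funext => x; rewrite mul0r addr0.
have bL : (fun x => b * g x) \in L.
  rewrite (_ : (fun x => b * g x) = fun x => b * g x + 0 * g x).
    exact: Lfun_lincomb.
  by apply/funext => x; rewrite mul0r addr0.
have abL : (fun x => a * f x + b * g x) \in L by exact: Lfun_lincomb.
have hab := Lnorm_pow p1 abL.
have ha := Lnorm_pow p1 aL; have hb := Lnorm_pow p1 bL.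
have ma := Lfun_measurable p1 aL; have mb := Lfun_measurable p1 bL.
have key : ('N[m]_p%:E[EFin \o (fun x => (a * f x + b * g x)%R)] <=
  'N[m]_p%:E[EFin \o (fun x => (a * f x)%R)] +
  'N[m]_p%:E[EFin \o (fun x => (b * g x)%R)])%E := minkowski_EFin m ma mb (ltW p1).
have real (X Y Z : \bar R) (x y z y' z' : R) : X = x%:E -> Y = y%:E -> Z = z%:E ->
    y = y' -> z = z' -> (X <= Y + Z)%E -> x <= y' + z'.
  by move=> -> -> -> -> ->; rewrite -EFinD lee_fin.
exact: (real _ _ _ _ _ _ _ _ hab ha hb (Lp_norm_scale a fL) (Lp_norm_scale b gL) key).
Qed.

End Lnorm_lincomb.

Section Lp_fast_convergence.
Context d (T : measurableType d) {R : realType}.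
Variables (m : {measure set T -> \bar R}) (p : R).
Hypothesis p1 : 1 < p.
Implicit Types f g : T -> R.
Local Notation L := (Lfun m p%:E).

Let p0 : 0 < p. Proof. exact: lt_trans ltr01 p1. Qed.
Let pn0 : p != 0. Proof. by rewrite gt_eqF. Qed.

(** Convergence at the rate [2^-(n+1)] makes the series of [|f_ n - f|^p]
integrable. Its sum is finite almost everywhere, which gives pointwise
convergence, and it dominates every term. No subsequence has to be chosen. *)
Lemma Lp_fast_cvg f (f_ : nat -> T -> R) : measurable_fun setT f ->
  (forall n, measurable_fun setT (f_ n)) ->
  (forall n, (\int[m]_x (`|f_ n x - f x| `^ p)%:E <= (1 / (2 ^ n.+1)%:R)%:E)%E) ->
  exists2 G : T -> R, m.-integrable setT (EFin \o G) &
    {ae m, forall x, (forall n, `|f_ n x - f x| `^ p <= G x) /\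
                     f_ ^~ x @ \oo --> f x}.
Proof.
move=> mf mf_ ff.
pose h n x := (`|f_ n x - f x| `^ p)%:E.
have h0 n x : (0 <= h n x)%E by rewrite lee_fin powR_ge0.
have mh n : measurable_fun setT (h n).
  by apply/measurable_EFinP; apply: measurable_powR_norm; exact: measurable_funB.
pose H x := (\sum_(n <oo) h n x)%E.
have H0 x : (0 <= H x)%E by exact: nneseries_ge0.
have mH : measurable_fun setT H by exact: ge0_emeasurable_sum.
have iH : m.-integrable setT H.
  apply/integrableP; split => //.
  under eq_integral do rewrite gee0_abs//.
  rewrite integral_nneseries//; apply: (@le_lt_trans _ _ 1%:E); last exact: ltry.
  apply: le_trans (@epsilon_trick0 R 1 xpredT ler01).
  apply: lee_nneseries => n _; last exact: ff.
  by move=> _; apply: integral_ge0.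
have Hfin := integrable_ae measurableT iH.
have iG : m.-integrable setT (EFin \o (fine \o H)).
  apply/integrableP; split.
    by apply/measurable_EFinP; apply: measurableT_comp => //.
  case/integrableP : (iH) => _; apply: le_lt_trans.
  apply: ae_ge0_le_integral => //.
  - by do 2 apply: measurableT_comp => //; apply: measurableT_comp => //.
  - by apply: measurableT_comp.
  - by apply: filterS Hfin => x + _ => /(_ I) xf; rewrite /= -[in leRHS](fineK xf).
exists (fine \o H) => //.
apply: filterS Hfin => x /(_ I) xf.
have hH n : (h n x <= H x)%E.
  apply: le_trans (nneseries_lim_ge n.+1 _); last by move=> *; exact: h0.
  rewrite big_nat_recr//= leeDr//; exact: sume_ge0.
split => [n|]; first by rewrite -lee_fin fineK//; exact: hH.
have hc : h ^~ x @ \oo --> 0%E.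
  apply: (@squeeze_cvge _ _ _ _ (cst 0%E) _
    (fun n => (\sum_(n <= k <oo) h k x)%E)); last 2 first.
  - exact: cvg_cst.
  - by apply: nneseries_tail_cvg => //; rewrite -/(H x) -(fineK xf) ltry.
  apply: nearW => n; rewrite h0/=.
  apply: le_trans (nneseries_lim_ge n.+1 _); last by move=> *; exact: h0.
  by rewrite big_nat1.
have hr : (fun n => `|f_ n x - f x| `^ p) @ \oo --> (0 : R).
  by have /fine_cvg := hc.
have pV0 : 0 < p^-1 by rewrite invr_gt0.
have := cvg_continuous (powR_norm_continuous pV0) hr.
rewrite normr0 powR0 ?invr_eq0// => h1.
apply/subr_cvg0/norm_cvg0P; apply: cvg_trans h1; apply: near_eq_cvg.
apply: nearW => n /=; rewrite ger0_norm ?powR_ge0//.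
by rewrite -powRrM mulfV// powRr1.
Qed.

(** The sum is at most twice the larger term. *)
Lemma powRD_le (a b : R) : 0 <= a -> 0 <= b ->
  (a + b) `^ p <= 2 `^ p * (a `^ p + b `^ p).
Proof.
move=> a0 b0; wlog ab : a b a0 b0 / a <= b.
  move=> H; case: (leP a b) => [|/ltW] ab; first exact: H.
  by rewrite addrC [X in _ * X]addrC; exact: H.
apply: (@le_trans _ _ ((2 * b) `^ p)).
  apply: ge0_ler_powR; rewrite ?nnegrE ?addr_ge0 ?mulr_ge0//; first exact: ltW.
  by rewrite mulr_natl mulr2n lerD2r.
by rewrite powRM// ler_wpM2l ?powR_ge0// lerDr powR_ge0.
Qed.

(** Here [|u_ n - u|] is at most [|f_ n - f| + 2 |f|], whose p-th power has an
integrable bound independent of [n]. *)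
Lemma Lp_dominated_cvg f (u : T -> R) (f_ u_ : nat -> T -> R) (G : T -> R) : f \in L ->
  measurable_fun setT u -> (forall n, measurable_fun setT (u_ n)) ->
  m.-integrable setT (EFin \o G) ->
  {ae m, forall x, forall n, `|f_ n x - f x| `^ p <= G x} ->
  {ae m, forall x, u_ ^~ x @ \oo --> u x} ->
  (forall x, `|u x| <= `|f x|) -> (forall n x, `|u_ n x| <= `|f_ n x|) ->
  forall e : R, 0 < e -> \forall n \near \oo, ('N[m]_p%:E[EFin \o (u_ n \- u)%R] < e%:E)%E.
Proof.
move=> fL mu mu_ iG fG uu uf uf_ e e0.
have f2L := Lfun_lincomb p1 1 1 (Lfun_norm p1 fL) (Lfun_norm p1 fL).
pose g x := 2 `^ p * (G x + `|1 * `|f x| + 1 * `|f x| | `^ p).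
have ig : m.-integrable setT (EFin \o g).
  rewrite (_ : EFin \o g = fun x => (2 `^ p)%:E *
    ((EFin \o G) x + (`|1 * `|f x| + 1 * `|f x| | `^ p)%:E))%E//.
  apply: integrableZl => //; apply: integrableD => //.
  exact: integrable_Lfun_powR p1 _ f2L.
have [] := @dominated_convergence _ _ _ m setT measurableT
  (fun n x => (`|u_ n x - u x| `^ p)%:E) (cst 0%E) (EFin \o g).
- move=> n; apply/measurable_EFinP; apply: measurable_powR_norm.
  exact: measurable_funB.
- exact: measurable_cst.
- apply: filterS uu => x ux _; apply: cvg_EFin; first exact: nearW.
  have ux0 : (fun n => u_ n x - u x) @ \oo --> 0 by exact/subr_cvg0.
  have := cvg_continuous (powR_norm_continuous p0) ux0.
  by rewrite normr0 powR0.
- exact: ig.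
- apply: filterS fG => x fGx n _; rewrite lee_fin ger0_norm ?powR_ge0//.
  apply: (@le_trans _ _ ((`|f_ n x - f x| + `|1 * `|f x| + 1 * `|f x| |) `^ p)).
    apply: ge0_ler_powR; rewrite ?nnegrE ?addr_ge0//; first exact: ltW.
    have ff0 : 0 <= `|f x| + `|f x| by rewrite addr_ge0.
    rewrite !mul1r (ger0_norm ff0).
    rewrite (le_trans (ler_normB _ _))// addrA lerD//.
    rewrite (le_trans (uf_ n x))//.
    by rewrite -{1}(subrK (f x) (f_ n x)) ler_normD.
  rewrite (le_trans (powRD_le _ _))// ler_wpM2l ?powR_ge0// lerD2r; exact: fGx.
move=> _ + _; rewrite /= => /(_ [set y | (y < (e `^ p)%:E)%E])/=.
have ep0 : (0 < (e `^ p)%:E)%E by rewrite lte_fin powR_gt0.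
move=> /(_ (open_ereal_lt' ep0)) [N _ hN]; exists N => // n /hN /=.
rewrite Lnorm_lt//; congr (_ < _)%E; apply: eq_integral => x _.
by rewrite subr0 ger0_norm ?powR_ge0.
Qed.

End Lp_fast_convergence.

(** * Borel sets of R^N *)

Section measurable_open_rV.
Context {R : realType} {n : nat}.
Implicit Types A : set 'rV[R]_n.

Let box (qk : 'rV[rat]_n * nat) : set 'rV[R]_n :=
  [set x | forall i, ball (ratr (qk.1 ord0 i) : R) (qk.2.+1%:R^-1) (x ord0 i)].

Let measurable_box qk : measurable (box qk).
Proof.
rewrite (_ : box qk = \bigcap_(i in [set: 'I_n])
    (fun x : 'rV[R]_n => x ord0 i) @^-1`
      ball (ratr (qk.1 ord0 i) : R) (qk.2.+1%:R^-1)).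
  apply: fin_bigcap_measurable => // i _.
  rewrite -[X in measurable X]setTI.
  by apply: (measurable_coord i measurableT); exact: measurable_ball.
by apply/seteqP; split => [x /= H i _|x /= H i]; [exact: H|exact: (H i I)].
Qed.

(** The sigma-algebra is generated by the coordinates, so rational boxes are
measurable, and an open set is the union of the countably many such boxes that
it contains. *)
Lemma open_measurable_rV A : open A -> measurable A.
Proof.
move=> oA.
have -> : A = \bigcup_(qk : 'rV[rat]_n * nat) (if `[< box qk `<=` A >] then box qk else set0).
  apply/seteqP; split => [x Ax|x [qk _]]; last by case: asboolP => // + xq; exact.
  have := open_nbhs_nbhs (conj oA Ax); rewrite -nbhs_ballE => -[e /= e0 xA].
  have e20 : 0 < e / 2 by rewrite divr_gt0.
  have [k _ hk] := near_infty_natSinv_lt (PosNum e20).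
  have {}hk : k.+1%:R^-1 < e / 2 by apply: hk => /=.
  have qex (i : 'I_n) : exists q : rat, ball (ratr q : R) k.+1%:R^-1 (x ord0 i).
    have : x ord0 i - k.+1%:R^-1 < x ord0 i + k.+1%:R^-1.
      have : 0 < k.+1%:R^-1 :> R by rewrite invr_gt0.
      by move=> r0; rewrite ltrBlDr -addrA ltrDl addr_gt0.
    move=> /rat_in_itvoo[q]; rewrite in_itv/= => /andP[q1 q2]; exists q.
    by rewrite /ball/= ltr_distl q1 q2.
  have [q hq] := choice qex.
  exists ((\row_i q i), k) => //; case: asboolP => [_ i|] /=; first by rewrite mxE.
  apply=> y hy; apply: xA; split => // i j; rewrite !ord1.
  have := hq j; have := hy j; rewrite /= mxE /ball/= => h1 h2.
  have -> : x 0 j - y 0 j = - (ratr (q j) - x 0 j) + (ratr (q j) - y 0 j) by ring.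
  rewrite (le_lt_trans (ler_normD _ _))// normrN.
  by rewrite (splitr e) ltrD ?(lt_trans _ hk).
apply: countable_bigcupT_measurable => [|qk]; first exact: countableP.
by case: asboolP.
Qed.

Lemma continuous_measurable_rV (f : 'rV[R]_n -> R) :
  continuous f -> measurable_fun setT f.
Proof.
move=> /continuousP cf; apply: (measurability _ (RGenOpens.measurableE R)).
move=> _ [_ [a [b ->] <-]]; rewrite setTI; apply: open_measurable_rV.
exact/cf/interval_open.
Qed.

End measurable_open_rV.

Section enorm_rV.
Context {R : realType} {N : nat}.
Local Notation E := 'rV[R]_N.

Lemma enorm_gt0 (x : E) : x != 0 -> 0 < enorm x.
Proof.
move=> x0; rewrite sqrtr_gt0 lt0r sumr_ge0 ?andbT; last by move=> *; exact: sqr_ge0.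
apply: contra_neq x0 => /eqP; rewrite psumr_eq0 => [/allP h|*]; last exact: sqr_ge0.
apply/rowP => i; rewrite mxE; apply/eqP.
by have := h i (mem_index_enum i); rewrite sqrf_eq0.
Qed.

Lemma measurable_enorm_sub :
  measurable_fun setT (fun z : E * E => enorm (z.1 - z.2)).
Proof.
have mc i : measurable_fun setT (fun z : E * E => (z.1 - z.2) ord0 i).
  under eq_fun do rewrite !mxE.
  apply: measurable_funB.
    exact: (measurableT_comp (measurable_coord i) measurable_fst).
  exact: (measurableT_comp (measurable_coord i) measurable_snd).
apply: (@measurableT_comp _ _ _ _ _ _ (@Num.sqrt R)).
  apply: continuous_measurable_fun; exact: sqrt_continuous.
apply: measurable_sum => i; exact: measurable_funX.
Qed.

End enorm_rV.

(** * Smooth functions *)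

Section smooth_functions.
Context {R : realType} {N : nat}.
Local Notation E := 'rV[R]_N.
Local Notation e_ i := (delta_mx ord0 i : E).
Implicit Types (f g r : E -> R) (i : 'I_N) (x : E).

(** Coinductive characterisation: any class stable under partial derivatives
whose members are continuous and have partial derivatives consists of smooth
functions. *)
Lemma smooth_stable (S : (E -> R) -> Prop) :
  (forall f, S f -> continuous f) ->
  (forall f i x, S f -> derivable f x (e_ i)) ->
  (forall f i, S f -> S ('D_(e_ i) f)) ->
  forall f, S f -> smooth f.
Proof.
move=> cS dS DS f Sf l.
have Sl : S (partials l f) by elim: l => //= i l IH; exact: DS.
by split; [exact: cS|move=> i x; exact: dS].
Qed.

Lemma smooth_continuous f : smooth f -> continuous f.
Proof. by move=> /(_ [::]) []. Qed.

Lemma smooth_derivable f i x : smooth f -> derivable f x (e_ i).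
Proof. by move=> /(_ [::]) [_]; exact. Qed.

Lemma smooth_partial f i : smooth f -> smooth ('D_(e_ i) f).
Proof.
move=> sf l; have := sf (rcons l i).
by rewrite /partials -cats1 foldr_cat.
Qed.

Lemma smooth_cst (c : R) : smooth (cst c : E -> R).
Proof.
apply: (@smooth_stable (fun f => exists c, f = cst c)); last by exists c.
- by move=> _ [d ->]; exact: cst_continuous.
- by move=> _ i x [d ->]; exact: derivable_cst.
- by move=> _ i [d ->]; exists 0; apply/funext => x; rewrite derive_cst.
Qed.

(** A directional derivative is a derivative on a line, which reduces the chain
rule to the one for functions of one variable. *)
Lemma is_derive_line (f : E -> R) x v df :
  is_derive x v f df <-> is_derive (0 : R) 1 (fun h : R => f (h *: v + x)) df.
Proof.
suff qE : (fun h : R => h^-1 *: ((f \o shift x) (h *: v) - f x)) =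
    (fun h : R => h^-1 *: (((fun k : R => f (k *: v + x)) \o shift 0) (h *: 1) -
                     f (0 *: v + x))).
  by split=> -[] dv vE; split; move: dv vE; rewrite /derivable /derive qE.
by apply/funext => h /=; rewrite addr0 scale0r add0r [_%:A]mulr1.
Qed.

Lemma is_derive_chain f x v (g : R -> R) df dg :
  is_derive x v f df -> is_derive (f x) 1 g dg ->
  is_derive x v (g \o f) (dg * df).
Proof.
move=> /is_derive_line hf hg; apply/is_derive_line.
apply: (@is_derive1_comp _ g (fun h : R => f (h *: v + x))) => //.
by rewrite scale0r add0r.
Qed.

Section algebra.
Variables (r : E -> R) (rho : 'I_N -> E -> R).
Hypotheses (r_gt0 : forall x, 0 < r x) (cr : continuous r).
Hypotheses (srho : forall i, smooth (rho i))
  (dr : forall i x, is_derive x (e_ i) r (rho i x / r x)).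

(** The partial derivatives of [r] are [rho i / r], so the algebra generated by
the smooth functions, [r] and [1 / r] is stable under partial derivatives. With
[r = 1] this yields sums and products, with [r] a square root the
regularisation of the absolute value. *)
Inductive smooth_alg : (E -> R) -> Prop :=
| smooth_alg_smooth f : smooth f -> smooth_alg f
| smooth_alg_add f g : smooth_alg f -> smooth_alg g -> smooth_alg (f + g)
| smooth_alg_mul f g : smooth_alg f -> smooth_alg g -> smooth_alg (f * g)
| smooth_alg_root : smooth_alg r
| smooth_alg_inv : smooth_alg (fun x => (r x)^-1).

Let r_neq0 x : r x != 0. Proof. by rewrite gt_eqF. Qed.

Let alg_derive f i : smooth_alg f -> 
  exists2 df, smooth_alg df & forall x, is_derive x (e_ i) f (df x).
Proof.
elim=> {f} [f sf|f g _ [df sdf hf] _ [dg sdg hg]|f g sf [df sdf hf] sg [dg sdg hg]||].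
- exists ('D_(e_ i) f); first by apply: smooth_alg_smooth; exact: smooth_partial.
  by move=> x; apply: derivableP; exact: smooth_derivable.
- exists (df + dg); first exact: smooth_alg_add.
  by move=> x; exact: is_deriveD.
- exists (f * dg + g * df); last by move=> x; exact: is_deriveM.
  by apply: smooth_alg_add; exact: smooth_alg_mul.
- exists (rho i * (fun x => (r x)^-1)); last exact: dr.
  by apply: smooth_alg_mul; [exact: smooth_alg_smooth|exact: smooth_alg_inv].
- pose rV : E -> R := fun x => (r x)^-1.
  exists (cst (-1) * (rho i * (rV * (rV * rV)))).
    do 2 (apply: smooth_alg_mul; first by apply: smooth_alg_smooth => //; exact: smooth_cst).
    by do 2 (apply: smooth_alg_mul; first exact: smooth_alg_inv); exact: smooth_alg_inv.
  move=> x; have [rd rE] := dr i x.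
  split; first exact: derivableV.
  rewrite deriveV// rE -[LHS]/(- (r x) ^- 2 * (rho i x / r x)).
  by rewrite -[RHS]/(-1 * (rho i x * ((r x)^-1 * ((r x)^-1 * (r x)^-1)))) -exprVn; ring.
Qed.

Lemma smooth_alg_is_smooth f : smooth_alg f -> smooth f.
Proof.
apply: smooth_stable => {f} [f|f i x /(alg_derive i)[df _ h]|f i /(alg_derive i)[df sdf h]].
- elim=> {f} [f|f g _ cf _ cg|f g _ cf _ cg||].
  + exact: smooth_continuous.
  + by move=> x; exact: (@cvgD _ _ _ _ _ f g _ _ (cf x) (cg x)).
  + by move=> x; exact: (@cvgM _ _ _ _ f g _ _ (cf x) (cg x)).
  + exact: cr.
  + move=> x; apply: (@continuous_comp _ _ _ r GRing.inv); first exact: cr.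
    exact: inv_continuous.
- by have [] := h x.
- rewrite (_ : 'D_(e_ i) f = df)//; apply/funext => x.
  by have [_ ->] := h x.
Qed.

End algebra.

Let smooth_alg1 f : smooth_alg (cst 1) f -> smooth f.
Proof.
apply: (@smooth_alg_is_smooth _ (fun _ => cst 0)) => //.
- exact: cst_continuous.
- by move=> _; exact: smooth_cst.
- by move=> i x; rewrite /= mul0r; exact: is_derive_cst.
Qed.

Lemma smoothD f g : smooth f -> smooth g -> smooth (f + g).
Proof. by move=> sf sg; apply/smooth_alg1/smooth_alg_add; exact: smooth_alg_smooth. Qed.

Lemma smoothM f g : smooth f -> smooth g -> smooth (f * g).
Proof. by move=> sf sg; apply/smooth_alg1/smooth_alg_mul; exact: smooth_alg_smooth. Qed.

Lemma smooth_sqrt f (e : R) : 0 < e -> smooth f ->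
  smooth (fun x => Num.sqrt (f x ^+ 2 + e ^+ 2)).
Proof.
move=> e0 sf; pose q x := f x ^+ 2 + e ^+ 2.
have q0 x : 0 < q x by rewrite ltr_wpDl ?sqr_ge0// exprn_gt0.
pose r x := Num.sqrt (q x).
have r0 x : 0 < r x by rewrite sqrtr_gt0.
have sq : smooth q.
  rewrite (_ : q = f * f + cst (e ^+ 2)); last by apply/funext => x; rewrite /q expr2.
  by apply: smoothD; [exact: smoothM|exact: smooth_cst].
apply: (@smooth_alg_is_smooth r (fun i => cst 2^-1 * 'D_(e_ i) q)).
- exact: r0.
- move=> x; apply: (@continuous_comp _ _ _ q Num.sqrt); last exact: sqrt_continuous.
  exact: smooth_continuous.
- by move=> i; apply: smoothM; [exact: smooth_cst|exact: smooth_partial].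
- move=> i x; have := is_derive_chain
    (derivableP (@smooth_derivable q i x sq)) (is_derive1_sqrt (q0 x)).
  move=> /is_derive_eq; apply.
  rewrite -[RHS]/(2^-1 * 'D_(e_ i) q x / r x) /r invfM; ring.
- exact: smooth_alg_root.
Qed.

End smooth_functions.

(** * A smooth approximation of the positive part on test functions *)

Section smooth_positive_part.
Context {R : realType}.
Implicit Types (e t a b : R).

Lemma max0E t : Num.max t 0 = (`|t| + t) / 2.
Proof.
by case: (lerP 0 t) => t0; [rewrite ger0_norm//|rewrite ltr0_norm//]; field.
Qed.

Lemma max0_lipschitz a b : `|Num.max a 0 - Num.max b 0| <= `|a - b|.
Proof.
rewrite !max0E; have := ler_dist_dist a b; set A := `|a|; set B := `|b| => AB.
have -> : (A + a) / 2 - (B + b) / 2 = (A - B) / 2 + (a - b) / 2 by field.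
rewrite (le_trans (ler_normD _ _))// !normrM (@ger0_norm _ 2^-1)//.
by rewrite -mulrDl ler_pdivrMr// mulr_natr mulr2n lerD2r.
Qed.

(** The half-sum of [t] and [sqrt (t^2 + e^2) - e]: smooth, 1-Lipschitz, within
[e] of the positive part, and zero at 0, so that composing with it does not
enlarge supports. *)
Definition smooth_pos e t : R := (Num.sqrt (t ^+ 2 + e ^+ 2) - e + t) / 2.

Lemma smooth_pos0 e : 0 <= e -> smooth_pos e 0 = 0.
Proof.
by move=> e0; rewrite /smooth_pos expr0n add0r sqrtr_sqr ger0_norm// subrr addr0 mul0r.
Qed.

Let norm_le_root e t : `|t| <= Num.sqrt (t ^+ 2 + e ^+ 2).
Proof. by rewrite -sqrtr_sqr ler_sqrt ?addr_ge0 ?sqr_ge0// lerDl sqr_ge0. Qed.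

Let root_le e t : 0 <= e -> Num.sqrt (t ^+ 2 + e ^+ 2) <= `|t| + e.
Proof.
move=> e0; rewrite -[leRHS]ger0_norm ?addr_ge0// -sqrtr_sqr ler_sqrt ?sqr_ge0//.
rewrite sqrrD real_normK ?num_real// lerD2r lerDl.
by rewrite pmulrn_lge0// mulr_ge0.
Qed.

(** With the two roots [A] and [B]: [(A - B) (A + B) = (a - b) (a + b)], and
[|a + b| <= A + B]. *)
Let root_lipschitz e a b : 0 < e ->
  `|Num.sqrt (a ^+ 2 + e ^+ 2) - Num.sqrt (b ^+ 2 + e ^+ 2)| <= `|a - b|.
Proof.
move=> e0; set A := Num.sqrt (a ^+ 2 + _); set B := Num.sqrt (b ^+ 2 + _).
have A0 : 0 < A by rewrite sqrtr_gt0 ltr_wpDl ?sqr_ge0// exprn_gt0.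
have B0 : 0 < B by rewrite sqrtr_gt0 ltr_wpDl ?sqr_ge0// exprn_gt0.
have AB : (A - B) * (A + B) = (a - b) * (a + b).
  by rewrite -!subr_sqr !sqr_sqrtr ?addr_ge0 ?sqr_ge0//; ring.
rewrite -(ler_pM2r (addr_gt0 A0 B0)) -{1}(gtr0_norm (addr_gt0 A0 B0)) -normrM AB.
by rewrite normrM ler_wpM2l// (le_trans (ler_normD _ _))// lerD// norm_le_root.
Qed.

Lemma smooth_pos_lipschitz e a b : 0 < e ->
  `|smooth_pos e a - smooth_pos e b| <= `|a - b|.
Proof.
move=> e0; have := root_lipschitz a b e0; rewrite /smooth_pos.
set A := Num.sqrt _; set B := Num.sqrt _ => AB.
have -> : (A - e + a) / 2 - (B - e + b) / 2 = (A - B) / 2 + (a - b) / 2 by field.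
rewrite (le_trans (ler_normD _ _))// !normrM (@ger0_norm _ 2^-1)//.
by rewrite -mulrDl ler_pdivrMr// mulr_natr mulr2n lerD2r.
Qed.

Lemma smooth_pos_approx e t : 0 < e -> `|smooth_pos e t - Num.max t 0| <= e.
Proof.
move=> e0; have h1 := norm_le_root e t; have h2 := root_le t (ltW e0).
rewrite max0E /smooth_pos ler_norml.
move: h1 h2; set A := Num.sqrt _ => h1 h2; apply/andP; split; lra.
Qed.

Lemma norm_smooth_pos_le e t : 0 < e -> `|smooth_pos e t| <= `|t|.
Proof.
move=> e0; have := smooth_pos_lipschitz t 0 e0.
by rewrite (smooth_pos0 (ltW e0)) !subr0.
Qed.

Lemma smooth_pos_cvg (e_ t_ : nat -> R) t : (forall n, 0 < e_ n) ->
  e_ @ \oo --> 0 -> t_ @ \oo --> t ->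
  (fun n => smooth_pos (e_ n) (t_ n)) @ \oo --> Num.max t 0.
Proof.
move=> e0 ce ct; apply/subr_cvg0/norm_cvg0P.
have c0 : (fun n => `|t_ n - t| + e_ n) @ \oo --> (0 : R).
  rewrite -[X in _ --> X](addr0 (0 : R)); apply: cvgD => //.
  by apply/norm_cvg0P/subr_cvg0.
apply: squeeze_cvgr c0; last exact: cvg_cst.
apply: nearW => n; rewrite normr_ge0/=.
rewrite -(subrK (smooth_pos (e_ n) t) (smooth_pos (e_ n) (t_ n))) -addrA.
rewrite (le_trans (ler_normD _ _))// lerD//; first exact: smooth_pos_lipschitz.
exact: smooth_pos_approx.
Qed.

End smooth_positive_part.

Section test_functions.
Context {R : realType} {N : nat}.
Local Notation E := 'rV[R]_N.
Variable Omega : set E.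
Implicit Types f g : E -> R.

Let compact_support_sub (A B : set E) : compact (closure B) ->
  closure B `<=` Omega -> A `<=` B ->
  compact (closure A) /\ closure A `<=` Omega.
Proof.
move=> cB BO AB; have AB' := closureS AB; split; last exact: subset_trans BO.
by apply: subclosed_compact cB _ => //; exact: closed_closure.
Qed.

Lemma Cc_infty_lincomb a b f g : Cc_infty Omega f -> Cc_infty Omega g ->
  Cc_infty Omega (fun x => a * f x + b * g x).
Proof.
move=> [sf [cf fO]] [sg [cg gO]]; split.
  exact: (smoothD (smoothM (smooth_cst a) sf) (smoothM (smooth_cst b) sg)).
apply: (@compact_support_sub _ ([set x | f x != 0] `|` [set x | g x != 0])).
- by rewrite closureU; exact: compactU.
- by rewrite closureU subUset.
- move=> x /= ; apply: contra_neqP => /not_orP[/negP/negPn/eqP -> /negP/negPn/eqP ->].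
  by rewrite !mulr0 addr0.
Qed.

Lemma Cc_infty_smooth_pos e f : 0 < e -> Cc_infty Omega f ->
  Cc_infty Omega (fun x => smooth_pos e (f x)).
Proof.
move=> e0 [sf [cf fO]]; split; last first.
  apply: compact_support_sub cf fO _ => x /=; apply: contra_neq => ->.
  by rewrite smooth_pos0// ltW.
exact: (smoothM (smoothD (smoothD (smooth_sqrt e0 sf) (smooth_cst (- e))) sf)
  (smooth_cst 2^-1)).
Qed.

Lemma Cc_infty_measurable f : Cc_infty Omega f -> measurable_fun setT f.
Proof. by move=> [sf _]; apply: continuous_measurable_rV; exact: smooth_continuous. Qed.

Lemma Cc_infty_out f x : Cc_infty Omega f -> ~ Omega x -> f x = 0.
Proof.
move=> [_ [_ fO]]; apply: contra_notP => /eqP fx; apply: fO.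
exact: subset_closure.
Qed.

End test_functions.

(** * The seminorm as an L^p norm over pairs of points *)

Section fractional_space.
Context {R : realType} {N : nat}.
Local Notation E := 'rV[R]_N.
Local Notation mu := (lebesgue_rV R N).
Variables (s p : R).
Hypothesis p1 : 1 < p.
Implicit Types (u v f g : E -> R).
Local Notation mu2 := (mu \x mu)%E.
Local Notation L := (Lfun mu p%:E).
Local Notation L2 := (Lfun mu2 p%:E).

Let p0 : 0 < p. Proof. exact: lt_trans ltr01 p1. Qed.
Let pn0 : p != 0. Proof. by rewrite gt_eqF. Qed.

(** The p-th root of [|x - y|^-(N + p s)], so that it can be moved inside the
power. *)
Definition kernel (z : E * E) : R :=
  enorm (z.1 - z.2) `^ (- (N%:R + p * s) / p).

Definition gdiff u (z : E * E) : R := (u z.1 - u z.2) * kernel z.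

Lemma kernel_ge0 z : 0 <= kernel z.
Proof. exact: powR_ge0. Qed.

Lemma kernel_gt0 z : z.1 != z.2 -> 0 < kernel z.
Proof.
by move=> z12; rewrite powR_gt0// enorm_gt0// subr_eq0.
Qed.

Lemma kernel_powR z : kernel z `^ p = (enorm (z.1 - z.2) `^ (N%:R + p * s))^-1.
Proof. by rewrite /kernel -powRrM divfK// powRN. Qed.

Lemma measurable_kernel : measurable_fun setT kernel.
Proof.
apply: (measurableT_comp (measurable_powR _)); exact: measurable_enorm_sub.
Qed.

Lemma measurable_gdiff u : measurable_fun setT u -> measurable_fun setT (gdiff u).
Proof.
move=> mu_; apply: measurable_funM; last exact: measurable_kernel.
by apply: measurable_funB; apply: measurableT_comp.
Qed.

Lemma gdiff_lincomb a b u v z :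
  gdiff (fun x => a * u x + b * v x) z = a * gdiff u z + b * gdiff v z.
Proof. by rewrite /gdiff; ring. Qed.

Lemma gdiffB u v z : gdiff (u \- v) z = gdiff u z - gdiff v z.
Proof. by rewrite /gdiff /=; ring. Qed.

Lemma norm_gdiff u z : `|gdiff u z| = `|u z.1 - u z.2| * kernel z.
Proof. by rewrite normrM (ger0_norm (kernel_ge0 z)). Qed.

Lemma gagliardo_Lnorm u : gagliardo s p u = 'N[mu2]_p%:E[EFin \o gdiff u]%E.
Proof.
rewrite unlock /gagliardo; congr (_ `^ _)%E; apply: eq_integral => z _.
by rewrite /= norm_gdiff powRM ?kernel_ge0// kernel_powR.
Qed.

Lemma D_gagliardo_phi u v :
  D_gagliardo s p u v = p * \int[mu2]_z (phi p (gdiff u z) * gdiff v z).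
Proof.
congr (_ * _); apply: eq_Rintegral => z _.
rewrite /gdiff phiM mulrACA phi_mul// (ger0_norm (kernel_ge0 z)) kernel_powR.
by rewrite /phi.
Qed.

Lemma Wsp_LfunP u : Wsp s p u <-> u \in L /\ gdiff u \in L2.
Proof.
rewrite /Wsp /= gagliardo_Lnorm; split => -[uL h]; split; try exact: uL.
  rewrite inE; apply/andP; split; rewrite inE/=.
    by apply: measurable_gdiff; exact: (Lfun_measurable p1 uL).
  exact: h.
by move: h; rewrite inE => /andP[_]; rewrite inE.
Qed.

(** The norm of the space as a real number; it is meaningful for functions with
finite [Wsp_norm], where the two agree. *)
Definition wnorm u : R := (\int[mu]_x (`|u x| `^ p)) `^ p^-1 +
  (\int[mu2]_z (`|gdiff u z| `^ p)) `^ p^-1.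

Lemma Wsp_norm_wnorm u : Wsp s p u -> Wsp_norm s p u = (wnorm u)%:E.
Proof.
move=> /Wsp_LfunP[uL gL]; rewrite /Wsp_norm gagliardo_Lnorm.
by rewrite (Lnorm_pow p1 uL) (Lnorm_pow p1 gL).
Qed.

Lemma wnorm_ge0 u : 0 <= wnorm u.
Proof. by rewrite addr_ge0 ?powR_ge0. Qed.

Lemma Wsp_lincomb a b u v : Wsp s p u -> Wsp s p v ->
  Wsp s p (fun x => a * u x + b * v x).
Proof.
move=> /Wsp_LfunP[uL guL] /Wsp_LfunP[vL gvL]; apply/Wsp_LfunP; split.
  exact: Lfun_lincomb.
rewrite (_ : gdiff _ = fun z => a * gdiff u z + b * gdiff v z).
  exact: Lfun_lincomb.
by apply/funext => z; rewrite gdiff_lincomb.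
Qed.

Lemma Wsp_norm_lt u e : measurable_fun setT u ->
  (Wsp_norm s p u < e%:E)%E -> Wsp s p u.
Proof.
move=> mu_ ue; apply/Wsp_LfunP.
have fin : (Wsp_norm s p u < +oo)%E by rewrite (lt_trans ue)// ltry.
split; rewrite inE; apply/andP; split; rewrite inE/=.
- exact: mu_.
- by apply: le_lt_trans fin; rewrite /Wsp_norm leeDl// gagliardo_Lnorm Lnorm_ge0.
- exact: measurable_gdiff.
- by apply: le_lt_trans fin; rewrite /Wsp_norm gagliardo_Lnorm leeDr// Lnorm_ge0.
Qed.

End fractional_space.

(** * Properties of the completion of the test functions *)

Section W0_space.
Context {R : realType} {N : nat}.
Local Notation E := 'rV[R]_N.
Local Notation mu := (lebesgue_rV R N).
Variables (s p : R) (Omega : set E).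
Hypothesis p1 : 1 < p.
Implicit Types (u v f g : E -> R).
Local Notation mu2 := (mu \x mu)%E.
Local Notation L := (Lfun mu p%:E).
Local Notation L2 := (Lfun mu2 p%:E).

Let p0 : 0 < p. Proof. exact: lt_trans ltr01 p1. Qed.

Lemma wnorm_lincomb a b u v : Wsp s p u -> Wsp s p v ->
  wnorm s p (fun x => a * u x + b * v x) <=
  `|a| * wnorm s p u + `|b| * wnorm s p v.
Proof.
move=> /(Wsp_LfunP s p1)[uL guL] /(Wsp_LfunP s p1)[vL gvL].
have h1 := Lp_norm_lincomb p1 a b uL vL.
have h2 := Lp_norm_lincomb p1 a b guL gvL.
rewrite /wnorm !mulrDr addrACA; apply: lerD; first exact: h1.
by under eq_Rintegral do rewrite gdiff_lincomb.
Qed.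

Lemma Lnorm_le_wnorm u : Wsp s p u -> ('N[mu]_p%:E[EFin \o u] <= (wnorm s p u)%:E)%E.
Proof.
move=> /(Wsp_LfunP s p1)[uL _].
by rewrite (Lnorm_pow p1 uL) lee_fin /wnorm lerDl powR_ge0.
Qed.

Lemma Lnorm_gdiff_le_wnorm u : Wsp s p u ->
  ('N[mu2]_p%:E[EFin \o gdiff s p u] <= (wnorm s p u)%:E)%E.
Proof.
move=> /(Wsp_LfunP s p1)[_ uL].
by rewrite (Lnorm_pow p1 uL) lee_fin /wnorm lerDr powR_ge0.
Qed.

Lemma Wsp_normE u : Wsp_norm s p u =
  ('N[mu]_p%:E[EFin \o u] + 'N[mu2]_p%:E[EFin \o gdiff s p u])%E.
Proof. by rewrite /Wsp_norm gagliardo_Lnorm. Qed.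

Local Opaque wnorm Wsp Wsp_norm gagliardo.

Lemma W0sp_Wsp u : W0sp s p Omega u -> Wsp s p u.
Proof. by case. Qed.

Lemma Wsp_measurable u : Wsp s p u -> measurable_fun setT u.
Proof. by move=> /(Wsp_LfunP s p1)[uL _]; exact: Lfun_measurable p1 _ uL. Qed.

Lemma W0sp_approx u e : W0sp s p Omega u -> 0 < e -> exists2 phi, Cc_infty Omega phi &
  Wsp s p (phi \- u) /\ wnorm s p (phi \- u) < e.
Proof.
move=> [Wu h] /h [phi cphi phie].
have mphi := Cc_infty_measurable cphi; have mu_ := Wsp_measurable Wu.
have W := Wsp_norm_lt p1 (measurable_funB mphi mu_) phie.
exists phi; [exact: cphi|split; first exact: W].
by move: phie; rewrite (Wsp_norm_wnorm p1 W) lte_fin.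
Qed.

Lemma W0sp_lincomb a b u v : W0sp s p Omega u -> W0sp s p Omega v ->
  W0sp s p Omega (fun x => a * u x + b * v x).
Proof.
move=> Wu Wv; split; first by apply: Wsp_lincomb => //; exact: W0sp_Wsp.
move=> e e0; pose d := e / (`|a| + `|b| + 1).
have c0 : 0 < `|a| + `|b| + 1 by rewrite ltr_wpDl ?addr_ge0.
have d0 : 0 < d by rewrite divr_gt0.
have [f cf [Wf fd]] := W0sp_approx Wu d0.
have [g cg [Wg gd]] := W0sp_approx Wv d0.
exists (fun x => a * f x + b * g x); first exact: Cc_infty_lincomb.
have -> : (fun x => a * f x + b * g x) \- (fun x => a * u x + b * v x) =
    fun x => a * (f \- u) x + b * (g \- v) x.
  by apply/funext => x /=; ring.
rewrite (Wsp_norm_wnorm p1 (Wsp_lincomb p1 a b Wf Wg)) lte_fin.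
rewrite (le_lt_trans (wnorm_lincomb a b Wf Wg))//.
apply: (@le_lt_trans _ _ ((`|a| + `|b|) * d)).
  rewrite mulrDl; apply: lerD; apply: ler_wpM2l; try exact: normr_ge0.
    exact: ltW fd.
  exact: ltW gd.
by rewrite /d mulrCA gtr_pMr// ltr_pdivrMr// mul1r ltrDl.
Qed.

(** Test functions vanish outside [Omega], so the integral of [|u|^p] there is at
most the p-th power of the distance from [u] to any of them. *)
Lemma W0sp_out u : measurable Omega -> W0sp s p Omega u ->
  {ae mu, forall x, ~ Omega x -> u x = 0}.
Proof.
move=> mO Wu; have mu_ := Wsp_measurable (W0sp_Wsp Wu).
have mF : measurable_fun setT (fun x => (`|u x| `^ p)%:E).
  by apply/measurable_EFinP; exact: measurable_powR_norm.
have mOC : measurable (~` Omega) by exact: measurableC.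
have I0 : (\int[mu]_(x in ~` Omega) (`|u x| `^ p)%:E <= 0)%E.
  apply/lee_addgt0Pr => e e0; rewrite add0e.
  have e0' : 0 < e `^ p^-1 by rewrite powR_gt0.
  have [f cf [Wf fe]] := W0sp_approx Wu e0'.
  have [fL _] := (Wsp_LfunP s p1 _).1 Wf.
  have : ('N[mu]_p%:E[EFin \o (f \- u)%R] < (e `^ p^-1)%:E)%E.
    by apply: le_lt_trans (Lnorm_le_wnorm Wf) _; rewrite lte_fin.
  move=> /(Lnorm_lt_root p1 e0).
  apply: le_trans.
  apply: (@le_trans _ _ (\int[mu]_(x in ~` Omega) (`|(f \- u) x| `^ p)%:E)%E).
    rewrite le_eqVlt; apply/orP; left; apply/eqP; apply: eq_integral => x.
    by rewrite inE => Ox; rewrite /= (Cc_infty_out cf Ox) sub0r normrN.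
  apply: ge0_subset_integral => //.
  apply/measurable_EFinP; apply: measurable_powR_norm.
  exact: Lfun_measurable p1 _ fL.
have I1 : (\int[mu]_(x in ~` Omega) `|(`|u x| `^ p)%:E| = 0)%E.
  apply/eqP; rewrite eq_le integral_ge0 ?andbT//.
  by apply: le_trans I0; rewrite le_eqVlt; apply/orP; left; apply/eqP;
    apply: eq_integral => x _; rewrite gee0_abs// lee_fin powR_ge0.
have : ae_eq mu (~` Omega) (fun x => (`|u x| `^ p)%:E) (cst 0%E).
  apply/(ae_eq_integral_abs _ mOC) => //.
  exact: measurable_funTS.
apply: filterS => x h Ox; have [/powR_eq0_eq0 /eqP] := h Ox.
by rewrite normr_eq0 => /eqP.
Qed.

Lemma Wsp_contraction v (w : E -> R) : Wsp s p v -> measurable_fun setT w ->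
  (forall x, `|w x| <= `|v x|) -> (forall x y, `|w x - w y| <= `|v x - v y|) ->
  Wsp s p w.
Proof.
move=> /(Wsp_LfunP s p1)[vL gvL] mw wv dwv; apply/(Wsp_LfunP s p1).
split; first exact: Lfun_le p1 _ _ mw vL wv.
apply: Lfun_le p1 _ _ _ gvL _; first exact: measurable_gdiff.
by move=> z; rewrite !norm_gdiff ler_wpM2r ?kernel_ge0.
Qed.

(** Test functions [f n] converging fast to [v] are turned into the test functions
[w n = smooth_pos (e_ n) (f n)], which converge almost everywhere to [v^+]. As
[smooth_pos] is 1-Lipschitz, [w n] is bounded by [f n] and the differences of
[w n] by those of [f n], so dominated convergence gives convergence in norm. *)
Lemma W0sp_ppart v : W0sp s p Omega v -> W0sp s p Omega (ppart v).
Proof.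
move=> Wv; have mv := Wsp_measurable (W0sp_Wsp Wv).
have mpv : measurable_fun setT (ppart v) by exact: measurable_maxr.
have pv x : `|ppart v x| <= `|v x|.
  by have := max0_lipschitz (v x) 0; rewrite maxxx !subr0.
split; first apply: Wsp_contraction (W0sp_Wsp Wv) mpv pv _.
  by move=> x y; exact: max0_lipschitz.
pose del n : R := (1 / (2 ^ n.+1)%:R) `^ p^-1.
have pow2_gt0 n : 0 < 1 / (2 ^ n.+1)%:R :> R by rewrite divr_gt0// ltr0n expn_gt0.
have del0 n : 0 < del n by rewrite powR_gt0.
have /choice[f hf] n : exists f, Cc_infty Omega f /\
    (Wsp s p (f \- v) /\ wnorm s p (f \- v) < del n).
  by have [f cf fd] := W0sp_approx Wv (del0 n); exists f.
have mf n : measurable_fun setT (f n) by apply: Cc_infty_measurable; exact: (hf n).1.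
have [vL gvL] := (Wsp_LfunP s p1 _).1 (W0sp_Wsp Wv).
have fast1 n : (\int[mu]_x (`|f n x - v x| `^ p)%:E <= (1 / (2 ^ n.+1)%:R)%:E)%E.
  have [cf [Wf fd]] := hf n; have [fL _] := (Wsp_LfunP s p1 _).1 Wf.
  have : ('N[mu]_p%:E[EFin \o (f n \- v)%R] < (del n)%:E)%E.
    by apply: le_lt_trans (Lnorm_le_wnorm Wf) _; rewrite lte_fin.
  exact: Lnorm_lt_root (pow2_gt0 n).
have fast2 n : (\int[mu2]_z (`|gdiff s p (f n) z - gdiff s p v z| `^ p)%:E <=
    (1 / (2 ^ n.+1)%:R)%:E)%E.
  have [cf [Wf fd]] := hf n; have [_ fL] := (Wsp_LfunP s p1 _).1 Wf.
  have : ('N[mu2]_p%:E[EFin \o gdiff s p (f n \- v)%R] < (del n)%:E)%E.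
    by apply: le_lt_trans (Lnorm_gdiff_le_wnorm Wf) _; rewrite lte_fin.
  move=> /(Lnorm_lt_root p1 (pow2_gt0 n)).
  by under eq_integral do rewrite gdiffB.
have [G1 iG1 ae1] := Lp_fast_cvg p1 mv mf fast1.
have [G2 iG2 ae2] := Lp_fast_cvg p1 (measurable_gdiff s p mv)
  (fun n => measurable_gdiff s p (mf n)) fast2.
pose e_ n : R := n.+1%:R^-1.
have e_0 n : 0 < e_ n by rewrite invr_gt0.
have ce : e_ @ \oo --> 0 by exact: cvg_harmonic.
pose w n x := smooth_pos (e_ n) (f n x).
have cw n : Cc_infty Omega (w n) by apply: Cc_infty_smooth_pos => //; exact: (hf n).1.
have mw n : measurable_fun setT (w n) by exact: Cc_infty_measurable (cw n).
have aew : {ae mu, forall x, w ^~ x @ \oo --> ppart v x}.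
  apply: filterS ae1 => x [_ fx]; exact: smooth_pos_cvg.
have aew2 : {ae mu2, forall z, (fun n => gdiff s p (w n) z) @ \oo -->
    gdiff s p (ppart v) z}.
  apply: filterS (ae_product aew aew) => z [z1 z2].
  by apply: cvgM; [exact: cvgB|exact: cvg_cst].
move=> e e0; have e20 : 0 < e / 2 by rewrite divr_gt0.
have h1 : \forall n \near \oo,
    ('N[mu]_p%:E[EFin \o (w n \- ppart v)%R] < (e / 2)%:E)%E.
  apply: (@Lp_dominated_cvg _ _ _ _ _ p1 v _ f _ G1 vL) => //.
  - by apply: filterS ae1 => x [].
  - by move=> n x; exact: norm_smooth_pos_le.
have h2 : \forall n \near \oo,
    ('N[mu2]_p%:E[EFin \o (gdiff s p (w n) \- gdiff s p (ppart v))%R] < (e / 2)%:E)%E.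
  apply: (@Lp_dominated_cvg _ _ _ _ _ p1 (gdiff s p v) _
    (fun n => gdiff s p (f n)) (fun n => gdiff s p (w n)) G2 gvL) => //.
  - exact: measurable_gdiff.
  - by move=> n; exact: measurable_gdiff.
  - by apply: filterS ae2 => x [].
  - by move=> z; rewrite !norm_gdiff ler_wpM2r ?kernel_ge0//; exact: max0_lipschitz.
  - move=> n z; rewrite !norm_gdiff ler_wpM2r ?kernel_ge0//.
    exact: smooth_pos_lipschitz.
have [n [hn1 hn2]] := filter_ex (filterI h1 h2).
exists (w n) => //.
rewrite Wsp_normE (splitr e) EFinD; apply: lteD => //.
rewrite (_ : gdiff s p _ = gdiff s p (w n) \- gdiff s p (ppart v))//.
by apply/funext => z; rewrite gdiffB.
Qed.

Lemma W0spN v : W0sp s p Omega v -> W0sp s p Omega (\- v).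
Proof.
move=> Wv; have := W0sp_lincomb (-1) 0 Wv Wv.
by congr (W0sp _ _ _ _); apply/funext => x; rewrite mul0r addr0 mulN1r.
Qed.

Lemma npartE v x : npart v x = - ppart (\- v) x.
Proof. by rewrite /npart /ppart /= oppr_max opprK oppr0. Qed.

Lemma W0sp_npart v : W0sp s p Omega v -> W0sp s p Omega (npart v).
Proof.
move=> Wv; rewrite (_ : npart v = \- ppart (\- v)).
  exact/W0spN/W0sp_ppart/W0spN.
by apply/funext => x; rewrite npartE.
Qed.

End W0_space.

(** * Loops in the unit sphere *)

Section sequential_neighborhoods.
Context {R : realType}.

(** Neighbourhood filters of a metric space are countably generated, so it is
enough to argue along sequences. *)
Lemma near_of_seq (T : pseudoMetricType R) (x : T) (P : T -> Prop) :
  (forall u : nat -> T, u @ \oo --> x -> \forall n \near \oo, P (u n)) ->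
  \forall y \near x, P y.
Proof.
move=> seqP; apply: contrapT => nP.
have /choice[u hu] (n : nat) : exists y, ball x (n.+1%:R^-1 : R) y /\ ~ P y.
  apply: contrapT => /forallNP h; apply: nP.
  rewrite -nbhs_nearE -nbhs_ballE; exists (n.+1%:R^-1 : R) => /=.
    by rewrite invr_gt0.
  by move=> y yb; apply: contrapT => Py; exact: (h y).
have cu : u @ \oo --> x.
  apply/cvg_ballP => e e0; near=> n.
  apply: le_ball (hu n).1; apply: ltW; near: n.
  exact: (near_infty_natSinv_lt (PosNum e0)).
have [n Pn] := filter_ex (seqP u cu).
exact: (hu n).2.
Unshelve. all: by end_near. Qed.

Lemma seq_continuous_at (T : pseudoMetricType R) (f : T -> R) (x : T) :
  (forall u : nat -> T, u @ \oo --> x -> (fun n => f (u n)) @ \oo --> f x) ->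
  {for x, continuous f}.
Proof.
move=> seqf; apply/cvgrPdist_lt => e e0.
apply: near_of_seq => u /seqf /cvgrPdist_lt; exact.
Qed.

Lemma compact_circle : compact (@circle R).
Proof.
have ccirc : closed (@circle R).
  have -> : @circle R = (fun t : R * R => t.1 * t.1 + t.2 * t.2) @^-1` [set 1].
    by apply/seteqP; split => t; rewrite /circle /= !expr2.
  apply: closed_comp; last exact: closed_eq.
  move=> t _; apply: cvgD; apply: cvgM; exact: cvg_fst || exact: cvg_snd.
apply: (@subclosed_compact _ _ (`[(-1 : R), 1]%classic `*` `[(-1 : R), 1]%classic)) => //.
  by apply: compact_setX; exact: segment_compact.
have sq1 (x y : R) : x ^+ 2 + y ^+ 2 = 1 -> -1 <= x <= 1.
  move=> h; rewrite -ler_norml -(@expr_le1 _ 2)// real_normK ?num_real// -h.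
  by rewrite lerDl sqr_ge0.
move=> t; rewrite /circle /= !in_itv/= => h; split; first exact: sq1 h.
by apply: (sq1 _ t.1); rewrite addrC.
Qed.

Lemma circle_neq0 : @circle R !=set0.
Proof. by exists (1, 0); rewrite /circle /= expr0n expr1n addr0. Qed.

End sequential_neighborhoods.

Section loops.
Context {R : realType} {N : nat}.
Local Notation E := 'rV[R]_N.
Local Notation mu := (lebesgue_rV R N).
Variables (s p : R) (Omega : set E).
Hypothesis p1 : 1 < p.
Implicit Types (u v f g : E -> R) (t : R * R).
Local Notation mu2 := (mu \x mu)%E.
Local Notation L := (Lfun mu p%:E).
Local Notation L2 := (Lfun mu2 p%:E).

Let p0 : 0 < p. Proof. exact: lt_trans ltr01 p1. Qed.

Definition energy u : R := \int[mu2]_z (`|gdiff s p u z| `^ p).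
Definition mass u : R := \int[mu]_x (`|u x| `^ p).

Lemma energy_ge0 u : 0 <= energy u.
Proof. by apply: Rintegral_ge0 => z _; exact: powR_ge0. Qed.

Lemma mass_ge0 u : 0 <= mass u.
Proof. by apply: Rintegral_ge0 => z _; exact: powR_ge0. Qed.

Lemma gagliardo_energy u : Wsp s p u -> (gagliardo s p u `^ p)%E = (energy u)%:E.
Proof.
move=> /(Wsp_LfunP s p1)[_ gL]; rewrite gagliardo_Lnorm// (Lnorm_pow p1 gL).
by rewrite poweR_EFin -powRrM mulVf ?gt_eqF// powRr1// energy_ge0.
Qed.

Lemma energy_scale c u : Wsp s p u -> energy (fun x => c * u x) = `|c| `^ p * energy u.
Proof.
move=> /(Wsp_LfunP s p1)[_ gL]; rewrite /energy -RintegralZl//.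
  apply: eq_Rintegral => z _; rewrite -powRM// -normrM; congr (`|_| `^ _).
  by rewrite /gdiff; ring.
exact: integrable_Lfun_powR gL.
Qed.

Lemma mass_scale c u : Wsp s p u -> mass (fun x => c * u x) = `|c| `^ p * mass u.
Proof.
move=> /(Wsp_LfunP s p1)[uL _]; rewrite /mass -RintegralZl//.
  by apply: eq_Rintegral => z _; rewrite -powRM// -normrM.
exact: integrable_Lfun_powR uL.
Qed.

Lemma massN u : mass (\- u) = mass u.
Proof. by apply: eq_Rintegral => z _; rewrite /= normrN. Qed.

Local Opaque wnorm Wsp Wsp_norm gagliardo.

Section three_parameters.
Variables (f g h : E -> R).
Hypotheses (Wf : Wsp s p f) (Wg : Wsp s p g) (Wh : Wsp s p h).
Variables (a_ b_ c_ : nat -> R) (a b c : R).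
Hypotheses (ca : a_ @ \oo --> a) (cb : b_ @ \oo --> b) (cc : c_ @ \oo --> c).

Lemma mass_cvg :
  (fun n => mass (fun x => a_ n * f x + b_ n * g x + c_ n * h x)) @ \oo -->
  mass (fun x => a * f x + b * g x + c * h x).
Proof.
have [fL _] := (Wsp_LfunP s p1 _).1 Wf; have [gL _] := (Wsp_LfunP s p1 _).1 Wg.
have [hL _] := (Wsp_LfunP s p1 _).1 Wh.
exact: cvg_int_powR.
Qed.

Lemma energy_cvg :
  (fun n => energy (fun x => a_ n * f x + b_ n * g x + c_ n * h x)) @ \oo -->
  energy (fun x => a * f x + b * g x + c * h x).
Proof.
have [_ fL] := (Wsp_LfunP s p1 _).1 Wf; have [_ gL] := (Wsp_LfunP s p1 _).1 Wg.
have [_ hL] := (Wsp_LfunP s p1 _).1 Wh.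
have gE a' b' c' : energy (fun x => a' * f x + b' * g x + c' * h x) =
    \int[mu2]_z (`|a' * gdiff s p f z + b' * gdiff s p g z +
                   c' * gdiff s p h z| `^ p).
  by apply: eq_Rintegral => z _; congr (`|_| `^ _); rewrite /gdiff; ring.
rewrite gE; under eq_fun do rewrite gE.
exact: cvg_int_powR.
Qed.

End three_parameters.

Local Opaque mass energy.

Variables (f g : E -> R).
Hypotheses (Wf : W0sp s p Omega f) (Wg : W0sp s p Omega g).

Let Wf' : Wsp s p f. Proof. exact: W0sp_Wsp Wf. Qed.
Let Wg' : Wsp s p g. Proof. exact: W0sp_Wsp Wg. Qed.

Let w t : E -> R := fun x => t.1 * f x + t.2 * g x.

Let wW t : Wsp s p (w t).
Proof. exact: (Wsp_lincomb p1 _ _ Wf' Wg'). Qed.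

Let w3 t : w t = fun x => t.1 * f x + t.2 * g x + 0 * f x.
Proof. by apply/funext => x; rewrite mul0r addr0. Qed.

Let cvg_pair (u : nat -> R * R) t : u @ \oo --> t ->
  (fun n => (u n).1) @ \oo --> t.1 /\ (fun n => (u n).2) @ \oo --> t.2.
Proof.
move=> ut; split; first exact: cvg_comp ut cvg_fst.
exact: cvg_comp ut cvg_snd.
Qed.

Let mass_seq (u : nat -> R * R) t : u @ \oo --> t ->
  (fun n => mass (w (u n))) @ \oo --> mass (w t).
Proof.
move=> /cvg_pair[u1 u2].
rewrite w3; under eq_fun do rewrite w3.
exact: (mass_cvg Wf' Wg' Wf' u1 u2 (cvg_cst _)).
Qed.

Let mass_cont t : {for t, continuous (fun t => mass (w t))}.
Proof. apply: seq_continuous_at => u; exact: mass_seq. Qed.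

Let energy_cont t : {for t, continuous (fun t => energy (w t))}.
Proof.
apply: seq_continuous_at => u /cvg_pair[u1 u2].
rewrite w3; under eq_fun do rewrite w3.
exact: (energy_cvg Wf' Wg' Wf' u1 u2 (cvg_cst _)).
Qed.

Variable lam : R.
Hypothesis lamE : lambda2 s p Omega = lam%:E.
Hypothesis below : forall t, circle t -> energy (w t) < lam * mass (w t).

Let mass_gt0 t : circle t -> 0 < mass (w t).
Proof.
move=> /below h; rewrite lt_neqAle mass_ge0 andbT; apply: contraTneq h => <-.
by rewrite mulr0 -leNgt energy_ge0.
Qed.

Let c t : R := mass (w t) `^ (- p^-1).
Let h t : E -> R := fun x => (c t * t.1) * f x + (c t * t.2) * g x.

Let hE t : h t = fun x => c t * w t x.
Proof. by apply/funext => x; rewrite /h /w; ring. Qed.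

Let h0 t : W0sp s p Omega (h t).
Proof. exact: (W0sp_lincomb p1 _ _ Wf Wg). Qed.

Let c_pow t : circle t -> `|c t| `^ p = (mass (w t))^-1.
Proof.
move=> ct; rewrite ger0_norm ?powR_ge0// /c -powRrM mulNr mulVf ?gt_eqF//.
by rewrite powR_inv1// mass_ge0.
Qed.

Let mass_h t : circle t -> mass (h t) = 1.
Proof.
by move=> ct; rewrite hE (mass_scale _ (wW t)) (c_pow ct) mulVf// gt_eqF// mass_gt0.
Qed.

Let energy_h t : circle t -> energy (h t) = energy (w t) / mass (w t).
Proof. by move=> ct; rewrite hE (energy_scale _ (wW t)) (c_pow ct) mulrC. Qed.

Let c_cont t : circle t -> {for t, continuous c}.
Proof.
move=> ct; apply: seq_continuous_at => u ut.
have hm := mass_seq ut.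
have pc : {for mass (w t), continuous (fun y : R => y `^ (- p^-1))}.
  apply/differentiable_continuous/derivable1_diffP/derivable_powR.
  by rewrite in_itv/= andbT mass_gt0.
exact: cvg_continuous_at pc hm.
Qed.

Let h_in_G2 : G2 s p Omega (h @` @circle R).
Proof.
split => [_ [t ct <-]|].
  split; first exact: h0.
  have [hL _] := (Wsp_LfunP s p1 _).1 (W0sp_Wsp (@h0 t)).
  by rewrite (Lnorm_pow p1 hL) [X in X `^ _](mass_h ct) powR1.
exists h; split.
- by move=> t ct; exists t.
- by move=> _ [t ct <-]; exists t => //; apply: aeW.
- move=> t ct; apply: aeW => x _ /=.
  have wN : w (- t) = \- w t by apply/funext => y; rewrite /w /=; ring.
  by rewrite !hE /c wN massN mulrN.
- move=> t ct e e0.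
  pose B := wnorm s p f + wnorm s p g + 1.
  have B0 : 0 < B by rewrite ltr_wpDl// addr_ge0// wnorm_ge0.
  have eB : 0 < e / B by rewrite divr_gt0.
  have near1 : \forall t' \near t, `|c t' * t'.1 - c t * t.1| < e / B.
    have : {for t, continuous (fun t' => c t' * t'.1)}.
      by apply: cvgM; [exact: c_cont|exact: cvg_fst].
    move/cvgrPdist_lt => /(_ _ eB); apply: filterS => t'; by rewrite distrC.
  have near2 : \forall t' \near t, `|c t' * t'.2 - c t * t.2| < e / B.
    have : {for t, continuous (fun t' => c t' * t'.2)}.
      by apply: cvgM; [exact: c_cont|exact: cvg_snd].
    move/cvgrPdist_lt => /(_ _ eB); apply: filterS => t'; by rewrite distrC.
  rewrite near_withinE; apply: filterS2 near1 near2 => t' n1 n2 _.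
  have -> : h t' \- h t = fun x => (c t' * t'.1 - c t * t.1) * f x +
                                   (c t' * t'.2 - c t * t.2) * g x.
    by apply/funext => x; rewrite /h /= !mulrBl opprD addrACA.
  rewrite (Wsp_norm_wnorm p1 (Wsp_lincomb p1 _ _ Wf' Wg')) lte_fin.
  apply: le_lt_trans (wnorm_lincomb p1 _ _ Wf' Wg') _.
  have wf0 := wnorm_ge0 s p f; have wg0 := wnorm_ge0 s p g.
  apply: (@le_lt_trans _ _ ((e / B) * (wnorm s p f + wnorm s p g))).
    rewrite [leRHS]mulrDr.
    exact: lerD (ler_wpM2r wf0 (ltW n1)) (ler_wpM2r wg0 (ltW n2)).
  by rewrite mulrAC ltr_pdivrMr// ltr_pM2l// /B ltrDl.
Qed.

(** The normalised circle [h] is an odd loop in the unit sphere. On it the energy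
is the ratio of energy and mass along [w]; were it below [lam], its maximum
over the compact circle would be below [lam] as well, against the definition
of the second eigenvalue as an infimum over loops. *)
Lemma loop_not_below : False.
Proof.
have ratio_cont : {within @circle R, continuous (fun t => energy (w t) / mass (w t))}.
  apply: continuous_in_subspaceT => t /[!inE] ct.
  apply: cvgM; first exact: energy_cont.
  by apply: cvgV; [rewrite gt_eqF// mass_gt0|exact: mass_cont].
have [t0] := compact_EVT_max circle_neq0 compact_circle ratio_cont.
rewrite inE => ct0 maxt0.
have : (lambda2 s p Omega <= (energy (w t0) / mass (w t0))%:E)%E.
  apply: (@le_trans _ _ (ereal_sup [set (gagliardo s p u `^ p)%E | u in h @` @circle R])).
    apply: ereal_inf_lbound; exists (h @` @circle R); first exact: h_in_G2.
    reflexivity.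
  apply: ge_ereal_sup => _ [_ [t ct <-] <-].
  rewrite (gagliardo_energy (W0sp_Wsp (@h0 t))) (energy_h ct) lee_fin.
  by apply: maxt0; rewrite inE.
by rewrite lamE lee_fin ler_pdivlMr ?mass_gt0// leNgt below.
Qed.

End loops.

(** * First variation and deformation of a plane *)

Section pairings.
Context {R : realType} {N : nat}.
Local Notation E := 'rV[R]_N.
Local Notation mu := (lebesgue_rV R N).
Variables (s p : R).
Hypothesis p1 : 1 < p.
Implicit Types (u v f g xi : E -> R).
Local Notation mu2 := (mu \x mu)%E.
Local Notation energy := (energy s p).
Local Notation mass := (mass p).

Let p0 : 0 < p. Proof. exact: lt_trans ltr01 p1. Qed.

Definition energy_pair u v : R := \int[mu2]_z (phi p (gdiff s p u z) * gdiff s p v z).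
Definition mass_pair u v : R := \int[mu]_x (phi p (u x) * v x).

(** The tangent inequality, integrated: a convex functional lies above its
tangents. *)
Lemma Lp_tangent d (T : measurableType d) (m : {measure set T -> \bar R})
    (X C : T -> R) (c : R) : X \in Lfun m p%:E -> C \in Lfun m p%:E ->
  \int[m]_x (`|X x| `^ p) + p * (c * \int[m]_x (phi p (X x) * C x)) <=
  \int[m]_x (`|X x + c * C x| `^ p).
Proof.
move=> XL CL.
have XcL : (fun x => X x + c * C x) \in Lfun m p%:E.
  rewrite (_ : (fun x => _) = fun x => 1 * X x + c * C x); first exact: Lfun_lincomb.
  by apply/funext => x; rewrite mul1r.
have iX := integrable_Lfun_powR p1 XL; have iXC := integrable_Lfun_powR p1 XcL.
have ip := integrable_phi p1 XL CL.
have ip2 : m.-integrable setT (EFin \o (fun x => (p * c) * (phi p (X x) * C x))).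
  have := integrableZl measurableT (p * c) ip.
  by apply: eq_integrable => // x _ /=; rewrite EFinM.
rewrite mulrA -(RintegralZl (p * c) measurableT ip) -(RintegralD measurableT iX ip2).
apply: le_Rintegral => //.
  have := integrableD measurableT iX ip2.
  by apply: eq_integrable => // x _ /=; rewrite EFinD.
move=> x _; have := phi_tangent (X x) (X x + c * C x) p1.
by rewrite (mulrDr (phi p (X x))) phi_mul//; lra.
Qed.

(** The tangent at the displaced point [u + c xi], read at [u]: an upper bound
for the increment of the energy in which only the pairing has to converge. *)
Lemma energy_tangent u xi c : Wsp s p u -> Wsp s p xi ->
  energy (fun x => u x + c * xi x) <=
  energy u + p * (c * energy_pair (fun x => u x + c * xi x) xi).
Proof.
move=> Wu Wx; have W1 := Wsp_lincomb p1 1 c Wu Wx.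
have [_ xL] := (Wsp_LfunP s p1 _).1 Wx; have [_ uL] := (Wsp_LfunP s p1 _).1 W1.
have e1 : (fun x => 1 * u x + c * xi x) = (fun x => u x + c * xi x).
  by apply/funext => x; rewrite mul1r.
rewrite e1 in uL; set W := fun x => u x + c * xi x.
have h : energy W + p * (- c * energy_pair W xi) <= energy u.
  apply: le_trans (Lp_tangent (- c) uL xL) _.
  rewrite le_eqVlt; apply/orP; left; apply/eqP.
  by apply: eq_Rintegral => z _; congr (`|_| `^ _); rewrite /gdiff; ring.
by move: h; rewrite mulNr mulrN lerBlDr.
Qed.

Lemma mass_tangent u xi c : Wsp s p u -> Wsp s p xi ->
  mass u + p * (c * mass_pair u xi) <= mass (fun x => u x + c * xi x).
Proof.
move=> Wu Wx.
have [xL _] := (Wsp_LfunP s p1 _).1 Wx; have [uL _] := (Wsp_LfunP s p1 _).1 Wu.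
exact: Lp_tangent.
Qed.

Section three_parameters.
Variables (f g h : E -> R).
Hypotheses (Wf : Wsp s p f) (Wg : Wsp s p g) (Wh : Wsp s p h).
Variables (a_ b_ c_ : nat -> R) (a b c : R).
Hypotheses (ca : a_ @ \oo --> a) (cb : b_ @ \oo --> b) (cc : c_ @ \oo --> c).

Lemma mass_pair_cvg :
  (fun n => mass_pair (fun x => a_ n * f x + b_ n * g x + c_ n * h x) h) @ \oo -->
  mass_pair (fun x => a * f x + b * g x + c * h x) h.
Proof.
have [fL _] := (Wsp_LfunP s p1 _).1 Wf; have [gL _] := (Wsp_LfunP s p1 _).1 Wg.
have [hL _] := (Wsp_LfunP s p1 _).1 Wh.
exact: cvg_int_phi.
Qed.

Lemma energy_pair_cvg :
  (fun n => energy_pair (fun x => a_ n * f x + b_ n * g x + c_ n * h x) h) @ \oo -->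
  energy_pair (fun x => a * f x + b * g x + c * h x) h.
Proof.
have [_ fL] := (Wsp_LfunP s p1 _).1 Wf; have [_ gL] := (Wsp_LfunP s p1 _).1 Wg.
have [_ hL] := (Wsp_LfunP s p1 _).1 Wh.
have gE a' b' c' : energy_pair (fun x => a' * f x + b' * g x + c' * h x) h =
    \int[mu2]_z (phi p (a' * gdiff s p f z + b' * gdiff s p g z +
                   c' * gdiff s p h z) * gdiff s p h z).
  by apply: eq_Rintegral => z _; congr (phi _ _ * _); rewrite /gdiff; ring.
rewrite gE; under eq_fun do rewrite gE.
exact: cvg_int_phi.
Qed.

End three_parameters.

Lemma mass_pair_scale c u v : Wsp s p u -> Wsp s p v ->
  mass_pair (fun x => c * u x) v = phi p c * mass_pair u v.
Proof.
move=> Wu Wv; have [uL _] := (Wsp_LfunP s p1 _).1 Wu.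
have [vL _] := (Wsp_LfunP s p1 _).1 Wv.
rewrite /mass_pair -(RintegralZl _ measurableT (integrable_phi p1 uL vL)).
by apply: eq_Rintegral => x _; rewrite phiM mulrA.
Qed.

Lemma energy_pair_scale c u v : Wsp s p u -> Wsp s p v ->
  energy_pair (fun x => c * u x) v = phi p c * energy_pair u v.
Proof.
move=> Wu Wv; have [_ uL] := (Wsp_LfunP s p1 _).1 Wu.
have [_ vL] := (Wsp_LfunP s p1 _).1 Wv.
rewrite /energy_pair -(RintegralZl _ measurableT (integrable_phi p1 uL vL)).
apply: eq_Rintegral => z _; rewrite mulrA -phiM; congr (phi _ _ * _).
by rewrite /gdiff; ring.
Qed.

End pairings.

Section deformation.
Context {R : realType} {N : nat}.
Local Notation E := 'rV[R]_N.
Variables (s p : R).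
Hypothesis p1 : 1 < p.
Local Opaque energy mass energy_pair mass_pair.
Local Notation energy := (energy s p).
Local Notation mass := (mass p).
Local Notation energy_pair := (energy_pair s p).
Local Notation mass_pair := (mass_pair p).
Variables (f g xi : E -> R) (lam : R).
Hypotheses (Wf : Wsp s p f) (Wg : Wsp s p g) (Wx : Wsp s p xi) (lam0 : 0 <= lam).

Let V (a b : R) : E -> R := fun x => a * f x + b * g x.
Let W (a b c : R) : E -> R := fun x => a * f x + b * g x + c * xi x.

Hypothesis off_diagonal : forall a b, a != b -> energy (V a b) < lam * mass (V a b).
Hypothesis diagonal : energy (V 1 1) <= lam * mass (V 1 1).
Hypothesis slope : energy_pair (V 1 1) xi < lam * mass_pair (V 1 1) xi.

Let p0 : 0 < p. Proof. exact: lt_trans ltr01 p1. Qed.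

Let WV a b : Wsp s p (V a b).
Proof. exact: (Wsp_lincomb p1 _ _ Wf Wg). Qed.

Let V_scale a : V a a = fun x => a * V 1 1 x.
Proof. by apply/funext => x; rewrite /V; ring. Qed.

Let W0V a b : W a b 0 = V a b.
Proof. by apply/funext => x; rewrite /W /V mul0r addr0. Qed.

Let everywhere a b : energy (V a b) <= lam * mass (V a b).
Proof.
have [->|ab] := eqVneq a b; last exact: ltW (off_diagonal ab).
rewrite V_scale (energy_scale p1 _ (WV 1 1)) (mass_scale p1 _ (WV 1 1)).
rewrite mulrCA; apply: ler_wpM2l diagonal; exact: powR_ge0.
Qed.

(** Off the diagonal the limit of [energy - lam * mass] is negative. On the
diagonal the limit may be 0, but the tangent inequalities bound
[energy - lam * mass] by [p * e * P], where [P] is [a + b] times the slope,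
and [P] tends to [2 phi (a) a] times the slope at [V 1 1]. *)
Let below_along_seq (a_ b_ e_ : nat -> R) (a b : R) : a_ @ \oo --> a -> b_ @ \oo --> b ->
  e_ @ \oo --> (0 : R) -> (a, b) != (0, 0) ->
  \forall n \near \oo, 0 < e_ n ->
    energy (W (a_ n) (b_ n) (e_ n * (a_ n + b_ n))) <
    lam * mass (W (a_ n) (b_ n) (e_ n * (a_ n + b_ n))).
Proof.
move=> ca cb ce ab0.
have cc : (fun n => e_ n * (a_ n + b_ n)) @ \oo --> 0 * (a + b).
  by apply: cvgM => //; exact: cvgD.
rewrite mul0r in cc.
have [eab|nab] := eqVneq a b; last first.
  have cE := energy_cvg p1 Wf Wg Wx ca cb cc.
  have cM := mass_cvg p1 Wf Wg Wx ca cb cc.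
  rewrite -!/(W _ _ _) W0V in cE cM.
  have cJ : (fun n => energy (W (a_ n) (b_ n) (e_ n * (a_ n + b_ n))) -
      lam * mass (W (a_ n) (b_ n) (e_ n * (a_ n + b_ n)))) @ \oo -->
      energy (V a b) - lam * mass (V a b).
    by apply: cvgB; [exact: cE|apply: cvgM; [exact: cvg_cst|exact: cM]].
  have lt0 : energy (V a b) - lam * mass (V a b) < 0.
    by rewrite subr_lt0; exact: off_diagonal nab.
  by apply: filterS (cvgn_lt0 cJ lt0) => n h _; rewrite -subr_lt0.
have cEP := energy_pair_cvg p1 Wf Wg Wx ca cb cc.
have cMP := mass_pair_cvg p1 Wf Wg Wx ca cb (@cvg_cst _ (0 : R) _ \oo _).
rewrite -!/(W _ _ _) W0V -eab V_scale in cEP cMP.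
rewrite (energy_pair_scale p1 a (WV 1 1) Wx) in cEP.
rewrite (mass_pair_scale p1 a (WV 1 1) Wx) in cMP.
rewrite -eab in cb.
have cP : (fun n => (a_ n + b_ n) *
    (energy_pair (W (a_ n) (b_ n) (e_ n * (a_ n + b_ n))) xi -
     lam * mass_pair (W (a_ n) (b_ n) 0) xi)) @ \oo -->
    (a + a) * (phi p a * energy_pair (V 1 1) xi -
               lam * (phi p a * mass_pair (V 1 1) xi)).
  apply: cvgM; first exact: cvgD.
  by apply: cvgB; [exact: cEP|apply: cvgM; [exact: cvg_cst|exact: cMP]].
have a0 : a != 0 by move: ab0; rewrite -eab; apply: contra_neq => ->.
have lt0 : (a + a) * (phi p a * energy_pair (V 1 1) xi -
                      lam * (phi p a * mass_pair (V 1 1) xi)) < 0.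
  have -> : (a + a) * (phi p a * energy_pair (V 1 1) xi -
                      lam * (phi p a * mass_pair (V 1 1) xi)) =
     (2 * (phi p a * a)) * (energy_pair (V 1 1) xi - lam * mass_pair (V 1 1) xi).
    by ring.
  rewrite phi_mul// pmulr_rlt0 ?subr_lt0; first exact: slope.
  by rewrite mulr_gt0// powR_gt0// normr_gt0.
apply: filterS (cvgn_lt0 cP lt0) => n hn e0.
set A := a_ n in hn *; set B := b_ n in hn *; set e := e_ n in e0 *.
have hE := energy_tangent p1 (e * (A + B)) (WV A B) Wx.
have hM := ler_wpM2l lam0 (mass_tangent p1 (e * (A + B)) (WV A B) Wx).
have h0 := everywhere A B.
move: hn; rewrite -/(W A B (e * (A + B))) W0V.
move: hE hM; rewrite -!/(W A B (e * (A + B))).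
set EP := energy_pair _ _; set MP := mass_pair _ _.
move: h0; set EV := energy (V _ _); set MV := mass (V _ _).
set EW := energy _; set MW := mass _ => h0 hE hM hn.
have : p * e * ((A + B) * (EP - lam * MP)) < 0 by rewrite pmulr_rlt0// mulr_gt0.
lra.
Qed.

(** The circle being compact, it suffices to find for each of its points a
neighbourhood on which all small [e] work. *)
Lemma deform_below : exists2 e : R, 0 < e & forall t : R * R, circle t ->
  energy (W t.1 t.2 (e * (t.1 + t.2))) < lam * mass (W t.1 t.2 (e * (t.1 + t.2))).
Proof.
pose P (e : R) (t : R * R) := 0 < e ->
  energy (W t.1 t.2 (e * (t.1 + t.2))) < lam * mass (W t.1 t.2 (e * (t.1 + t.2))).
have : \forall e \near (0 : R), @circle R `<=` P e.
  have cover := iffLR (compact_near_coveringP _) (@compact_circle R).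
  apply: (cover R (nbhs (0 : R)) P) => t ct.
  have nz : (t.1, t.2) != (0, 0).
    apply/negP => /eqP[t1 t2]; move: ct; rewrite /circle /= t1 t2 expr0n addr0.
    by move/eqP; rewrite eq_sym oner_eq0.
  apply: (@near_of_seq R (R * R * R)%type (t, 0)
    (fun q : R * R * R => P q.2 q.1)) => u cu.
  have c1 : (fun n => (u n).1) @ \oo --> t by exact: cvg_comp cu cvg_fst.
  apply: below_along_seq nz.
  - exact: cvg_comp c1 cvg_fst.
  - exact: cvg_comp c1 cvg_snd.
  - exact: cvg_comp cu cvg_snd.
move=> /nbhs_ballP[d /= d0 hd]; exists (d / 2); first by rewrite divr_gt0.
move=> t ct; apply: hd ct _; last by rewrite divr_gt0.
rewrite /ball/= sub0r normrN gtr0_norm ?divr_gt0//.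
by rewrite ltr_pdivrMr// mulr_natr mulr2n ltrDl.
Qed.

End deformation.

(** * The plane spanned by the positive and the negative part *)

Section sign_parts.
Context {R : realType} {N : nat}.
Local Notation E := 'rV[R]_N.
Local Notation mu := (lebesgue_rV R N).
Variables (s p : R) (Omega : set E).
Hypothesis p1 : 1 < p.
Hypothesis mO : measurable Omega.
Implicit Types (u v xi : E -> R).
Local Notation mu2 := (mu \x mu)%E.
Local Notation energy := (energy s p).
Local Notation mass := (mass p).
Local Notation energy_pair := (energy_pair s p).
Local Notation mass_pair := (mass_pair p).
Local Notation W0 := (W0sp s p Omega).

Let p0 : 0 < p. Proof. exact: lt_trans ltr01 p1. Qed.

Lemma D_gagliardo_energy_pair u xi : D_gagliardo s p u xi = p * energy_pair u xi.
Proof. exact: D_gagliardo_phi. Qed.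

Lemma mass_in_Omega u : W0 u -> \int[mu]_(x in Omega) (`|u x| `^ p) = mass u.
Proof.
move=> Wu; apply: Rintegral_support => //.
  by apply: measurable_powR_norm; exact: (Wsp_measurable p1 (W0sp_Wsp Wu)).
apply: filterS (W0sp_out p1 mO Wu) => x h /h ->.
by rewrite normr0 powR0// gt_eqF.
Qed.

Lemma mass_pair_in_Omega u xi : W0 u -> W0 xi ->
  \int[mu]_(x in Omega) (`|u x| `^ (p - 2) * u x * xi x) = mass_pair u xi.
Proof.
move=> Wu Wx; apply: Rintegral_support => //.
  apply: measurable_funM; last exact: (Wsp_measurable p1 (W0sp_Wsp Wx)).
  by apply: measurable_phi; exact: (Wsp_measurable p1 (W0sp_Wsp Wu)).
by apply: filterS (W0sp_out p1 mO Wx) => x h /h ->; rewrite mulr0.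
Qed.

Lemma mass_pair_ppart u : mass_pair u (ppart u) = mass (ppart u).
Proof. by apply: eq_Rintegral => x _; exact: phi_max0. Qed.

Lemma mass_pair_npart u : mass_pair u (npart u) = mass (npart u).
Proof. by apply: eq_Rintegral => x _; exact: phi_min0. Qed.

Lemma mass_pair_self u : mass_pair u u = mass u.
Proof. by apply: eq_Rintegral => x _; exact: phi_mul. Qed.

Lemma mass_pairN u xi : Wsp s p u -> Wsp s p xi ->
  mass_pair u (\- xi) = - mass_pair u xi.
Proof.
move=> /(Wsp_LfunP s p1)[uL _] /(Wsp_LfunP s p1)[xL _].
rewrite -mulN1r -(RintegralZl (-1) measurableT (integrable_phi p1 uL xL)).
by apply: eq_Rintegral => x _; rewrite mulN1r mulrN.
Qed.

Lemma energy_pairN u xi : Wsp s p u -> Wsp s p xi ->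
  energy_pair u (\- xi) = - energy_pair u xi.
Proof.
move=> /(Wsp_LfunP s p1)[_ uL] /(Wsp_LfunP s p1)[_ xL].
rewrite -mulN1r -(RintegralZl (-1) measurableT (integrable_phi p1 uL xL)).
apply: eq_Rintegral => z _; rewrite mulN1r -mulrN; congr (_ * _).
by rewrite /gdiff /=; ring.
Qed.

Lemma mass_eq0 u : Wsp s p u -> mass u = 0 -> u = cst 0 %[ae mu].
Proof.
move=> /(Wsp_LfunP s p1)[uL _] mu0.
have N0 : 'N[mu]_p%:E[EFin \o u]%E = 0%E.
  rewrite (Lnorm_pow p1 uL) [X in X `^ _]mu0 powR0// invr_eq0 gt_eqF//.
have mu_ : measurable_fun setT (EFin \o u).
  by apply/measurable_EFinP; exact: (Lfun_measurable p1 uL).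
have p0E : (0 < p%:E)%E by rewrite lte_fin.
by apply: filterS (Lnorm_eq0_eq0 mu_ p0E N0) => x h /h [].
Qed.

Lemma parts_sum v : (fun x => 1 * ppart v x + 1 * npart v x) = v.
Proof. by apply/funext => x; rewrite !mul1r; exact: max_min0. Qed.

Section parts_of_v.
Variables (v : E -> R).
Hypothesis Wv : W0 v.

Let Wp : Wsp s p (ppart v). Proof. exact: (W0sp_Wsp (W0sp_ppart p1 Wv)). Qed.
Let Wn : Wsp s p (npart v). Proof. exact: (W0sp_Wsp (W0sp_npart p1 Wv)). Qed.
Let Wv' : Wsp s p v. Proof. exact: W0sp_Wsp Wv. Qed.

Lemma mass_parts a b : mass (fun x => a * ppart v x + b * npart v x) =
  `|a| `^ p * mass (ppart v) + `|b| `^ p * mass (npart v).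
Proof.
have [pL _] := (Wsp_LfunP s p1 _).1 Wp; have [nL _] := (Wsp_LfunP s p1 _).1 Wn.
have ip := integrable_Lfun_powR p1 pL; have i_n := integrable_Lfun_powR p1 nL.
rewrite -(Rintegral_lincomb _ _ ip i_n).
by apply: eq_Rintegral => x _; exact: powR_parts.
Qed.

Let A := gdiff s p (ppart v).
Let B := gdiff s p (npart v).

Let gdiff_sum z : gdiff s p v z = A z + B z.
Proof.
rewrite /A /B /gdiff -mulrDl; congr (_ * _).
by rewrite addrACA -opprD /ppart /npart !max_min0.
Qed.

Let AB0 z : 0 <= A z * B z.
Proof.
rewrite /A /B /gdiff mulrACA; apply: mulr_ge0; first exact: diff_parts_ge0.
by rewrite mulr_ge0 ?kernel_ge0.
Qed.

Let gdiff_parts a b z :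
  gdiff s p (fun x => a * ppart v x + b * npart v x) z = a * A z + b * B z.
Proof. exact: gdiff_lincomb. Qed.

Let integrable_parts a b : mu2.-integrable setT
  (EFin \o (fun z => `|gdiff s p (fun x => a * ppart v x + b * npart v x) z| `^ p)).
Proof.
have W := Wsp_lincomb p1 a b Wp Wn; have [_ wL] := (Wsp_LfunP s p1 _).1 W.
exact: integrable_Lfun_powR wL.
Qed.

Let iA : mu2.-integrable setT (EFin \o (fun z => phi p (gdiff s p v z) * A z)).
Proof.
have [_ vL] := (Wsp_LfunP s p1 _).1 Wv'; have [_ pL] := (Wsp_LfunP s p1 _).1 Wp.
exact: integrable_phi.
Qed.

Let iB : mu2.-integrable setT (EFin \o (fun z => phi p (gdiff s p v z) * B z)).
Proof.
have [_ vL] := (Wsp_LfunP s p1 _).1 Wv'; have [_ nL] := (Wsp_LfunP s p1 _).1 Wn.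
exact: integrable_phi.
Qed.

Lemma energy_parts_le a b : energy (fun x => a * ppart v x + b * npart v x) <=
  `|a| `^ p * energy_pair v (ppart v) + `|b| `^ p * energy_pair v (npart v).
Proof.
rewrite -(Rintegral_lincomb _ _ iA iB); apply: le_Rintegral => //.
  exact: integrable_lincomb.
by move=> z _; rewrite gdiff_parts gdiff_sum; exact: powR_jensen.
Qed.

Hypothesis pos : ~ (ppart v = cst 0 %[ae mu]).
Hypothesis neg : ~ (npart v = cst 0 %[ae mu]).

Let mv : measurable_fun setT v. Proof. exact: (Wsp_measurable p1 Wv'). Qed.
Let P : set E := [set x | 0 < v x].
Let M : set E := [set x | v x < 0].

Let mP : measurable P.
Proof.
rewrite -[P]setTI (_ : P = v @^-1` `]0, +oo[%classic).
  exact: mv.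
by apply/seteqP; split => x; rewrite /P /= in_itv/= andbT.
Qed.

Let mM : measurable M.
Proof.
rewrite -[M]setTI (_ : M = v @^-1` `]-oo, 0[%classic).
  exact: mv.
by apply/seteqP; split => x; rewrite /M /= in_itv/=.
Qed.

Let P_gt0 : (0 < mu P)%E.
Proof.
rewrite lt0e measure_ge0 andbT; apply/eqP => P0; apply: pos.
exists P; split => // x /= /not_implyP[_ vx]; rewrite /P /= ltNge; apply/negP => v0.
by apply: vx; rewrite /ppart; exact: max_r.
Qed.

Let M_gt0 : (0 < mu M)%E.
Proof.
rewrite lt0e measure_ge0 andbT; apply/eqP => M0; apply: neg.
exists M; split => // x /= /not_implyP[_ vx]; rewrite /M /= ltNge; apply/negP => v0.
by apply: vx; rewrite /npart; exact: min_r.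
Qed.

(** Jensen's inequality is strict at pairs [z] with [v z.1 > 0 > v z.2], a set of
positive product measure. *)
Lemma energy_parts_lt a b : a != b ->
  energy (fun x => a * ppart v x + b * npart v x) <
  `|a| `^ p * energy_pair v (ppart v) + `|b| `^ p * energy_pair v (npart v).
Proof.
move=> ab; rewrite -(Rintegral_lincomb _ _ iA iB).
apply: (@Rintegral_lt _ _ _ mu2 _ _ (P `*` M)).
- exact: measurableX.
- have PM : (mu2 (P `*` M) = mu P * mu M)%E by exact: product_measure1E.
  by rewrite [X in (0 < X)%E]PM mule_gt0.
- exact: integrable_parts.
- exact: integrable_lincomb.
- by move=> z; rewrite gdiff_parts gdiff_sum; exact: powR_jensen.
- move=> z [/= Pz Mz]; rewrite gdiff_parts gdiff_sum; apply: powR_jensen_lt => //.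
  have k0 : 0 < kernel s p z.
    apply: kernel_gt0; apply/eqP => z12; move: Pz Mz.
    by rewrite /P /M /= z12 => h1 h2; have := lt_trans h1 h2; rewrite ltxx.
  rewrite /A /B /gdiff /ppart /npart; rewrite /P /M /= in Pz Mz.
  rewrite (max_l (ltW Pz)) (max_r (ltW Mz)) (min_r (ltW Pz)) (min_l (ltW Mz)).
  by rewrite subr0 sub0r !mulr_gt0// oppr_gt0.
Qed.

End parts_of_v.

End sign_parts.

(** * Comparison with a second eigenfunction *)

Section eigenfunctions.
Context {R : realType} {N : nat}.
Local Notation E := 'rV[R]_N.
Local Notation mu := (lebesgue_rV R N).
Variables (s p : R) (Omega : set E).
Hypothesis p1 : 1 < p.
Hypothesis mO : measurable Omega.
Implicit Types (u v xi : E -> R).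

Let p0 : 0 < p. Proof. exact: lt_trans ltr01 p1. Qed.

Local Opaque energy mass energy_pair mass_pair wnorm Wsp Wsp_norm gagliardo D_gagliardo.

Lemma lambda2_ge0 : (0 <= lambda2 s p Omega)%E.
Proof.
apply: le_ereal_inf_tmp => _ [A [AS [h [hA _ _ _]]] <-].
have [t ct] := @circle_neq0 R.
apply: (@le_trans _ _ (gagliardo s p (h t) `^ p)%E); first exact: poweR_ge0.
by apply: ereal_sup_ubound; exists (h t) => //; exact: hA.
Qed.

(** An infinite value would contradict the equation of [u] tested with [u]: the
left-hand side is real and [mass u] is positive. *)
Lemma lambda2_fin u : second_eigenfunction s p Omega u ->
  exists2 lam : R, 0 <= lam & lambda2 s p Omega = lam%:E.
Proof.
move=> [Wu u0 eq]; have Wu' := W0sp_Wsp Wu.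
have m0 : 0 < mass p u.
  rewrite lt_neqAle mass_ge0 andbT eq_sym; apply/eqP => /(mass_eq0 p1 Wu').
  exact: u0.
have := eq u Wu; rewrite (mass_pair_in_Omega p1 mO Wu Wu) (mass_pair_self p1).
have := lambda2_ge0; case: (lambda2 s p Omega) => [r r0 _|_|//].
  by exists r.
by rewrite gt0_mulye ?lte_fin.
Qed.

Lemma second_eigenfunctionP lam u : lambda2 s p Omega = lam%:E ->
  second_eigenfunction s p Omega u <->
  [/\ W0sp s p Omega u, ~ (u = cst 0 %[ae mu]) &
    forall xi, W0sp s p Omega xi -> energy_pair s p u xi = lam * mass_pair p u xi].
Proof.
move=> lamE; rewrite /second_eigenfunction lamE; split=> -[Wu u0 eq]; split => // xi Wx.
  have := eq xi Wx; rewrite (mass_pair_in_Omega p1 mO Wu Wx) D_gagliardo_energy_pair//.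
  by rewrite mulKf ?gt_eqF// -EFinM => -[].
rewrite (mass_pair_in_Omega p1 mO Wu Wx) D_gagliardo_energy_pair//.
by rewrite mulKf ?gt_eqF// -EFinM eq.
Qed.

(** The function [u] enters only through four numbers: the masses [mu_p], [mu_n]
of its parts and the pairings [eu_p], [eu_n] with them. *)
Section comparison.
Variables (lam : R) (v : E -> R) (eu_p eu_n mu_p mu_n : R).
Hypotheses (lam0 : 0 <= lam) (lamE : lambda2 s p Omega = lam%:E).
Hypothesis Wv : W0sp s p Omega v.
Hypothesis pos : ~ (ppart v = cst 0 %[ae mu]).
Hypothesis neg : ~ (npart v = cst 0 %[ae mu]).
Hypotheses (eigp : eu_p = lam * mu_p) (eign : eu_n = lam * mu_n).
Hypotheses (mp : mu_p <= mass p (ppart v)) (mn : mu_n <= mass p (npart v)).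
Hypotheses (ep : energy_pair s p v (ppart v) <= eu_p)
           (en : energy_pair s p v (npart v) <= eu_n).

Let f := ppart v.
Let g := npart v.
Let V (a b : R) : E -> R := fun x => a * f x + b * g x.

Let Wf : W0sp s p Omega f. Proof. exact: W0sp_ppart. Qed.
Let Wg : W0sp s p Omega g. Proof. exact: W0sp_npart. Qed.

Let bound a b : `|a| `^ p * energy_pair s p v f + `|b| `^ p * energy_pair s p v g <=
  lam * mass p (V a b).
Proof.
have -> := mass_parts p1 Wv a b.
apply: weighted_sum_le; try exact: powR_ge0.
  by apply: le_trans ep _; rewrite eigp; exact: (ler_wpM2l lam0 mp).
by apply: le_trans en _; rewrite eign; exact: (ler_wpM2l lam0 mn).
Qed.

Let off_diagonal a b : a != b -> energy s p (V a b) < lam * mass p (V a b).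
Proof.
move=> ab; exact: lt_le_trans (energy_parts_lt p1 Wv pos neg ab) (bound a b).
Qed.

Let V11 : V 1 1 = v.
Proof. exact: parts_sum. Qed.

(** Otherwise the energy of [v^+] would be negative. *)
Let lam_gt0 : 0 < lam.
Proof.
rewrite lt_neqAle lam0 andbT; apply/eqP => lam_eq0.
have := off_diagonal (oner_neq0 R); rewrite -lam_eq0 mul0r.
by rewrite ltNge energy_ge0.
Qed.

Let not_below : ~ (energy s p v < lam * mass p v).
Proof.
move=> below; apply: (loop_not_below p1 Wf Wg lamE) => t ct.
have [e|ne] := eqVneq t.1 t.2; last exact: off_diagonal ne.
have tE : (fun x => t.1 * f x + t.2 * g x) = fun x => t.1 * v x.
  by apply/funext => x; rewrite -e -mulrDr; congr (_ * _); exact: max_min0.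
have Wv' := W0sp_Wsp Wv.
rewrite tE (energy_scale p1 _ Wv') (mass_scale p1 _ Wv') mulrCA.
rewrite ltr_pM2l// powR_gt0// normr_gt0; apply: contraPneq ct => t10.
rewrite /circle /= -e t10 expr0n addr0 => /eqP.
by rewrite eq_sym oner_eq0.
Qed.

Let energy_v : energy s p v = lam * mass p v.
Proof.
apply/eqP; rewrite eq_le; apply/andP; split; last by rewrite leNgt; apply/negP.
by rewrite -{1 2}V11; exact: le_trans (energy_parts_le p1 Wv 1 1) (bound 1 1).
Qed.

(** Since [energy v = lam * mass v], the chain of inequalities from the sum of the
two pairings to [lam * mass v] closes up, term by term; [lam > 0] turns the
equality of [lam * mass] into that of the masses. *)
Lemma comparison_equalities :
  [/\ mass p (ppart v) = mu_p, mass p (npart v) = mu_n,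
      energy_pair s p v (ppart v) = eu_p & energy_pair s p v (npart v) = eu_n].
Proof.
have h1 := energy_parts_le p1 Wv 1 1; have h2 := mass_parts p1 Wv 1 1.
have one : `|1 : R| `^ p = 1 by rewrite normr1 powR1.
rewrite parts_sum one !mul1r in h1 h2.
rewrite energy_v h2 in h1.
have k1 : lam * mu_p <= lam * mass p f := ler_wpM2l lam0 mp.
have k2 : lam * mu_n <= lam * mass p g := ler_wpM2l lam0 mn.
have e1 := ep; have e2 := en; rewrite eigp in e1; rewrite eign in e2.
rewrite [leLHS]mulrDr in h1.
have [e3 e4 e5 e6] := squeeze_pair e1 e2 k1 k2 h1.
have lamI := mulfI (negbT (gt_eqF lam_gt0)).
by split; [exact: lamI e5|exact: lamI e6|rewrite eigp; exact: e3|rewrite eign; exact: e4].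
Qed.

Let no_descent xi : W0sp s p Omega xi ->
  ~ (energy_pair s p v xi < lam * mass_pair p v xi).
Proof.
move=> Wx slope; rewrite -{1 2}V11 in slope.
have diag : energy s p (V 1 1) <= lam * mass p (V 1 1) by rewrite V11 energy_v.
have [e e0 he] := deform_below p1 (W0sp_Wsp Wf) (W0sp_Wsp Wg) (W0sp_Wsp Wx) lam0
  off_diagonal diag slope.
have Wfe := W0sp_lincomb p1 1 e Wf Wx; have Wge := W0sp_lincomb p1 1 e Wg Wx.
apply: (loop_not_below p1 Wfe Wge lamE) => t /he.
have rearrange (t1 t2 F G X : R) : t1 * (1 * F + e * X) + t2 * (1 * G + e * X) =
    t1 * F + t2 * G + e * (t1 + t2) * X by ring.
have -> : (fun x => t.1 * (1 * f x + e * xi x) + t.2 * (1 * g x + e * xi x)) =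
    (fun x => t.1 * f x + t.2 * g x + e * (t.1 + t.2) * xi x).
  by apply/funext => x; exact: rearrange.
exact: id.
Qed.

Lemma comparison_eigenfunction : second_eigenfunction s p Omega v.
Proof.
apply/(second_eigenfunctionP _ lamE); split => //.
  move=> v0; apply: pos; apply: filterS v0 => x h /h vx.
  by rewrite /ppart vx /cst; exact: maxxx.
move=> xi Wx; apply/eqP; rewrite eq_le; apply/andP; split; rewrite leNgt; apply/negP.
  have Wv' := W0sp_Wsp Wv; have Wx' := W0sp_Wsp Wx => h.
  apply: (no_descent (W0spN p1 Wx)).
  by rewrite (energy_pairN p1 Wv' Wx') (mass_pairN p1 Wv' Wx') mulrN ltrN2.
exact: no_descent.
Qed.

End comparison.

End eigenfunctions.

Theorem proposition3p2 (R : realType) (s p : R) (N : nat)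
  (Omega : set 'rV[R]_N) (u v : 'rV[R]_N -> R)
  (mu := lebesgue_rV R N)
  (hs : 0 < s < 1) (hp : 1 < p) (hN : (1 <= N)%N)
  (hOmega_open : open Omega) (hOmega_bounded : bounded_set Omega)
  (hu : second_eigenfunction s p Omega u)
  (hv : W0sp s p Omega v)
  (hvp : ~ (ppart v = cst 0 %[ae mu in Omega]))
  (hvn : ~ (npart v = cst 0 %[ae mu in Omega]))
  (hLp : \int[mu]_(x in Omega) (`|ppart v x| `^ p) >=
         \int[mu]_(x in Omega) (`|ppart u x| `^ p))
  (hLn : \int[mu]_(x in Omega) (`|npart v x| `^ p) >=
         \int[mu]_(x in Omega) (`|npart u x| `^ p))
  (hDp : D_gagliardo s p v (ppart v) <= D_gagliardo s p u (ppart u))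
  (hDn : D_gagliardo s p v (npart v) <= D_gagliardo s p u (npart u)) :
  second_eigenfunction s p Omega v /\
  [/\ \int[mu]_(x in Omega) (`|ppart v x| `^ p) =
      \int[mu]_(x in Omega) (`|ppart u x| `^ p),
      \int[mu]_(x in Omega) (`|npart v x| `^ p) =
      \int[mu]_(x in Omega) (`|npart u x| `^ p),
      D_gagliardo s p v (ppart v) = D_gagliardo s p u (ppart u) &
      D_gagliardo s p v (npart v) = D_gagliardo s p u (npart u)].
Proof.
have p0 : 0 < p := lt_trans ltr01 hp.
have mO : measurable Omega := open_measurable_rV hOmega_open.
have [lam lam0 lamE] := lambda2_fin hp mO hu.
have [Wu _ equ] := (second_eigenfunctionP hp mO u lamE).1 hu.
have Wup := W0sp_ppart hp Wu; have Wun := W0sp_npart hp Wu.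
have Wvp := W0sp_ppart hp hv; have Wvn := W0sp_npart hp hv.
have eigp : energy_pair s p u (ppart u) = lam * mass p (ppart u).
  by rewrite (equ _ Wup) (mass_pair_ppart hp).
have eign : energy_pair s p u (npart u) = lam * mass p (npart u).
  by rewrite (equ _ Wun) (mass_pair_npart hp).
have pos : ~ (ppart v = cst 0 %[ae mu]).
  by move=> v0; apply: hvp; apply: filterS v0 => x h _; exact: h.
have neg : ~ (npart v = cst 0 %[ae mu]).
  by move=> v0; apply: hvn; apply: filterS v0 => x h _; exact: h.
have mvp := mass_in_Omega hp mO Wvp; have mvn := mass_in_Omega hp mO Wvn.
have mup := mass_in_Omega hp mO Wup; have mun := mass_in_Omega hp mO Wun.
rewrite mvp mup in hLp *; rewrite mvn mun in hLn *.
rewrite !(D_gagliardo_energy_pair _ hp) in hDp hDn *.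
rewrite !(ler_pM2l p0) in hDp hDn.
split.
  exact: (comparison_eigenfunction hp mO lam0 lamE hv pos neg eigp eign
    hLp hLn hDp hDn).
have [-> -> -> ->] := comparison_equalities hp lam0 lamE hv pos neg eigp eign
  hLp hLn hDp hDn.
split; reflexivity.
Qed.
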